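(* Let $M$ be one of $\mathbb R$, $I=[-1,1]$, $\mathbb T^1$, let $f:M\to M$ satisfy A1 and A2 (see context), and let $(\xi_n)_{n\ge1}$ be a sequence of independent real random variables on $(\Omega,\mathcal F,\mathbb P)$ with $p>2$ finite moments satisfying A3($p$) (see context). Let $s=\min(p,3)$. Assume that for some $x\in M$ and some increasing sequence of positive integers $(n_k)$, $$\lim_{k\to\infty}\frac{\Lambda_p(x,n_k)}{(\Lambda_2(x,n_k))^{p/2}}=0 .$$ If $(\sigma_k)$ is a sequence of positive numbers such that $$\frac{(\widehat\Lambda(x,n_k))^3}{\sqrt{\operatorname{var}[L_{n_k}(x)]}}\,\|f''\|_{C_0}\,\Big\|\max_{1\le j\le n_k}|\xi_j|\Big\|_s^2\,\sigma_k\le\left(\frac{\Lambda_s(x,n_k)}{(\Lambda_2(x,n_k))^{s/2}}\right)^2 ,$$ then there are events $B_k\in\mathcal F$ with $\lim_k\mathbb P[B_k]=1$ such that $$\sup_{z\in\mathbb R}\big|\mathbb P[w_{n_k}(x,\sigma_k)\mathbf 1_{B_k}\le z]-\Phi(z)\big|\le A\,\frac{\Lambda_s(x,n_k)}{(\Lambda_2(x,n_k))^{s/2}},$$ where $A>0$ depends only on $x$ (for the given $f$ and $(\xi_n)$), and $$w_{n_k}(x,\sigma_k)=\frac{x_{n_k}(x,\sigma_k)-f^{n_k}(x)}{\sigma_k\sqrt{\operatorname{var}[L_{n_k}(x)]}} .$$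
   Context: $\Phi(z)=\frac1{\sqrt{2\pi}}\int_{-\infty}^z e^{-t^2/2}dt$. Assumptions. A1: $f:M\to M$ is $C^2$, where $M=\mathbb R$, $I=[-1,1]$ or $\mathbb T^1$. A2: if $M=I$, there is $a>0$ such that $f\in C^2([-1-a,1+a])$ and $f([-1-a,1+a])\subset I$. A3($p$): $\mathbb E[\xi_n]=0$ for all $n$, and there are constants $c,C>0$ with $c\le\|\xi_n\|_2\le\|\xi_n\|_p\le C$ for all $n$, where $\|\xi\|_s=(\mathbb E|\xi|^s)^{1/s}$. For a function $h$ on $M$, $\|h\|_{C_0}=\sup_{x\in M}|h(x)|$. The noisy system. For $x\in M$ and $\sigma>0$ put $x_0=x$, $x_m=f(x_{m-1})+\sigma\xi_m$, and let $x_n(x,\sigma)$ be the value at time $n$. For $M=\mathbb T^1$, orbits and differences are computed using a lift of $f$ to $\mathbb R$. For $M=I$, $x_n(x,\sigma)$ is defined by this recursion on the event $\Omega\setminus C_n$, $C_n=\{\sigma\max_{1\le j\le n}|\xi_j|>a\}$ (on which the orbit stays in $[-1-a,1+a]$), and one conditions on that event. Lyapunov functions. For $s\ge0$, $$\Lambda_s(x,n)=\sum_{j=1}^n\big|(f^{n-j})'\circ f^j(x)\big|^s,\qquad \widehat\Lambda(x,n)=\max_{0\le i\le n}\sum_{j=0}^i\big|(f^{i-j})'\circ f^j(x)\big| .$$ Linearized effective noise: $L_n(x)=\sum_{j=1}^n (f^{n-j})'\circ f^j(x)\,\xi_j$. Here $f^0=\mathrm{id}$. *)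

(* Defs.v *)
From HB Require Import structures.
From mathcomp Require Import all_boot all_order all_algebra.
From mathcomp Require Import all_classical all_reals all_analysis.

Set Implicit Arguments.
Unset Strict Implicit.
Unset Printing Implicit Defensive.

Import Order.TTheory GRing.Theory Num.Theory.
Import numFieldNormedType.Exports.

Local Open Scope ring_scope.
Local Open Scope classical_set_scope.

(* The phase space M. [Interval a] is I = [-1, 1] together with a margin a > 0
   such that the map extends to [-1 - a, 1 + a] with values in I. In all
   cases the map is given by a function f : R -> R:
   - for [Interval a], only the values of f on [-1 - a, 1 + a] are relevant;
   - for [Circle] (T^1 = R / Z), f is a lift of the circle map, and points of
     the circle are given by real representatives. *)
Inductive phase_space (R : Type) : Type := Line | Circle | Interval of R.
Arguments Line {R}.
Arguments Circle {R}.
Arguments Interval {R}.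

Definition carrier (R : realType) (M : phase_space R) : set R :=
  match M with
  | Line | Circle => setT
  | Interval _ => `[-1, 1]
  end.

Definition C2 (R : realType) (f : R -> R) : Prop :=
  [/\ forall t, derivable f t 1,
      forall t, derivable f^`() t 1 &
      continuous f^`(2)].

(* C^2 on the closed segment [u, v]: f is twice differentiable inside, and f, f'
   and f'' have continuous extensions to [u, v]. The derivatives of f : R -> R at
   the endpoints are not used: they would involve values outside [u, v]. *)
Definition C2_segment (R : realType) (u v : R) (f : R -> R) : Prop :=
  [/\ {within `[u, v], continuous f},
      {in `]u, v[, forall t, derivable f t 1 /\ derivable f^`() t 1},
      exists2 g : R -> R,
        {within `[u, v], continuous g} & {in `]u, v[, f^`() =1 g} &
      exists2 g : R -> R,
        {within `[u, v], continuous g} & {in `]u, v[, f^`(2) =1 g}].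

(* On the circle, d is the degree of the map. *)
Definition admissible_map (R : realType) (M : phase_space R) (f : R -> R) : Prop :=
  match M with
  | Line => C2 f
  | Circle => C2 f /\ exists d : int, forall t, f (t + 1) = f t + d%:~R
  | Interval a =>
      [/\ 0 < a, C2_segment (-1 - a) (1 + a) f &
          f @` `[-1 - a, 1 + a] `<=` `[-1, 1]]
  end.

Definition C0_norm (R : realType) (M : phase_space R) (h : R -> R) : \bar R :=
  ereal_sup [set (`|h t|)%:E | t in carrier M].

(* (f^(n-j))' o f^j (x) *)
Definition dflow (R : realType) (f : R -> R) (x : R) (n j : nat) : R :=
  derive1 (iter (n - j)%N f) (iter j f x).

Definition Lambda (R : realType) (f : R -> R) (s x : R) (n : nat) : R :=
  \sum_(1 <= j < n.+1) `|dflow f x n j| `^ s.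

Definition Lambda_hat (R : realType) (f : R -> R) (x : R) (n : nat) : R :=
  \big[Num.max/0]_(0 <= i < n.+1) \sum_(0 <= j < i.+1) `|dflow f x i j|.

Definition Phi (R : realType) (z : R) : R :=
  (Num.sqrt (2 * pi))^-1 *
  \int[lebesgue_measure]_(t in `]-oo, z]) expR (- t ^+ 2 / 2).

(* The noise is indexed from 1: the value xi 0 is never used. *)
Definition independent_noise d (T : measurableType d) (R : realType)
    (P : probability T R) (xi : nat -> {RV P >-> R}) : Prop :=
  forall (J : seq nat) (E : nat -> set R),
    uniq J -> {in J, forall j, (0 < j)%N} -> (forall j, measurable (E j)) ->
    P (\bigcap_(j in [set` J]) (xi j @^-1` E j)) =
    (\prod_(j <- J) P (xi j @^-1` E j))%E.

Definition noise_moments d (T : measurableType d) (R : realType) (P : probability T R)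
    (xi : nat -> {RV P >-> R}) (p : R) : Prop :=
  (forall n, (0 < n)%N -> ('E_P[xi n] = 0)%E) /\
  exists c C : R, [/\ 0 < c, 0 < C &
    forall n, (0 < n)%N ->
      (c%:E <= 'N[P]_(2%:E)[EFin \o xi n] /\
       'N[P]_(2%:E)[EFin \o xi n] <= 'N[P]_(p%:E)[EFin \o xi n] /\
       'N[P]_(p%:E)[EFin \o xi n] <= C%:E)%E].

Definition max_noise (T : Type) (R : realType) (xi : nat -> T -> R)
    (n : nat) (w : T) : R :=
  \big[Num.max/0]_(1 <= j < n.+1) `|xi j w|.

Definition linear_noise (T : Type) (R : realType) (xi : nat -> T -> R)
    (f : R -> R) (x : R) (n : nat) (w : T) : R :=
  \sum_(1 <= j < n.+1) dflow f x n j * xi j w.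

Definition sd_noise d (T : measurableType d) (R : realType)
    (P : probability T R) (xi : nat -> T -> R) (f : R -> R) (x : R)
    (n : nat) : R :=
  Num.sqrt (fine 'V_P[linear_noise xi f x n]%E).

(* For [Interval a] the orbit is only meaningful outside [exit_event] below,
   where it stays in [-1 - a, 1 + a]. *)
Fixpoint noisy_orbit (T : Type) (R : realType) (xi : nat -> T -> R)
    (f : R -> R) (sigma x : R) (n : nat) (w : T) : R :=
  if n is m.+1 then f (noisy_orbit xi f sigma x m w) + sigma * xi n w else x.

Definition exit_event (T : Type) (R : realType) (M : phase_space R)
    (xi : nat -> T -> R) (sigma : R) (n : nat) : set T :=
  match M with
  | Line | Circle => set0
  | Interval a => [set w | a < sigma * max_noise xi n w]
  end.

(* Elementary conditional probability (0 by convention when P G = 0);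
   cond_prob P setT E is P E. *)
Definition cond_prob d (T : measurableType d) (R : realType)
    (P : probability T R) (G E : set T) : R :=
  fine (P (E `&` G)) / fine (P G).

Definition effective_noise d (T : measurableType d) (R : realType)
    (P : probability T R) (xi : nat -> T -> R) (f : R -> R) (sigma x : R)
    (n : nat) (w : T) : R :=
  (noisy_orbit xi f sigma x n w - iter n f x) / (sigma * sd_noise P xi f x n).

(* Main.v *)
Require Import Defs.
From HB Require Import structures.
From mathcomp Require Import all_boot all_order all_algebra.
From mathcomp Require Import all_classical all_reals all_analysis.
From mathcomp Require Import measurable_realfun ring lra.

Import Order.TTheory GRing.Theory Num.Theory.
Import numFieldNormedType.Exports.

Set Implicit Arguments.
Unset Strict Implicit.
Unset Printing Implicit Defensive.

Local Open Scope ring_scope.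
Local Open Scope classical_set_scope.

(** Why the theorem holds. Write D for the ratio Lambda_s / Lambda_2 ^ (s / 2),
K for a bound on the individual kicks sigma * xi_j, F for the supremum of |f''|
and Lh for Lambda_hat.

The difference between the noisy orbit and the orbit of f satisfies the
linearized recursion, up to second-order Taylor remainders of f. By variation of
constants it is sigma * L_n plus a sum of propagated remainders, and as long as
F * Lh ^ 2 * K is small a bootstrap bounds that sum by a multiple of
F * Lh ^ 3 * K ^ 2 ([orbit_linearization]).

The sum L_n has independent centred terms with bounded moments of order s, so its
normalization is within a multiple of D of a standard Gaussian in the Kolmogorov
distance ([linear_noise_clt]).

It remains to choose the event on which the kicks are called small. With N the
L^s norm of max_j |xi_j|, take B to be the event max_j |xi_j| <= N / sqrt D.
Chebyshev's inequality bounds the probability of its complement by D. On B one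
can take K = sigma * N / sqrt D, and the nonlinear error divided by sigma * sd is
a multiple of (Lh ^ 3 / sd * F * N ^ 2 * sigma) / D, which is at most D by the
assumption on sigma. Both the exceptional event and the nonlinear error thus cost
O(D), like the central limit theorem itself; as Phi is 1-Lipschitz, the three
errors add up, also after conditioning ([cond_prob_approx]). All this asks D to
be below a threshold; above it the empty event B will do, because distances of
distribution functions are at most 1 ([effective_noise_clt]). The ratio of order
s tends to 0 along with the ratio of order p ([lyapunov_ratio_cvg0]), so D is
eventually below the threshold and P (B_k) >= 1 - D_k tends to 1.

The Berry-Esseen bound is proved by Stein's method in the form given to it by
Chen and Shao. If S is the sum and W_i is S without its i-th term, then
E [S g(S)] for the Stein solution g is a sum of increments
E [X_i (g(S) - g(W_i))], and g' is replaced by g'(W_i), which is independent of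
X_i. The derivative g' jumps at z, so one has to know how likely W_i is to lie
within |X_i| of z; this is the concentration inequality [concentration]. The
resulting error is a sum of E [X_i ^ 2 min(1, |X_i|)], and each term is at most
E |X_i| ^ s for every s between 2 and 3.

Two degenerate cases are excluded by the assumptions. If F is infinite, the
condition on sigma fails. On the interval, F only controls f'' on [-1, 1] whereas
the noisy orbit visits the margin, where f'' is merely bounded. If F > 0 the two
bounds differ by a constant factor. If F = 0, then f is affine on [-1, 1] with a
slope of absolute value less than 1 ([affine_interval]), so that Lambda_2 stays
bounded and the ratio of order p does not tend to 0. *)

(** * Independence *)

Section indep.
Context d (T : measurableType d) (R : realType) (P : probability T R).

Definition indep2 d1 d2 (T1 : measurableType d1) (T2 : measurableType d2)
    (X : T -> T1) (Y : T -> T2) :=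
  forall (A : set T1) (B : set T2), measurable A -> measurable B ->
  P (X @^-1` A `&` Y @^-1` B) = (P (X @^-1` A) * P (Y @^-1` B))%E.

Lemma indep2_comp d1 d2 d3 d4 (T1 : measurableType d1) (T2 : measurableType d2)
    (T3 : measurableType d3) (T4 : measurableType d4)
    (X : T -> T1) (Y : T -> T2) (g : T1 -> T3) (h : T2 -> T4) :
  measurable_fun setT g -> measurable_fun setT h ->
  indep2 X Y -> indep2 (g \o X) (h \o Y).
Proof.
move=> mg mh XY A B mA mB; apply: (XY (g @^-1` A) (h @^-1` B)).
- by rewrite -[X in measurable X]setTI; exact: mg.
- by rewrite -[X in measurable X]setTI; exact: mh.
Qed.

Lemma indep2_Tonelli d1 d2 (T1 : measurableType d1) (T2 : measurableType d2)
    (X : T -> T1) (Y : T -> T2) (g : T1 * T2 -> \bar R) :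
  measurable_fun setT X -> measurable_fun setT Y -> indep2 X Y ->
  measurable_fun setT g -> (forall z, 0 <= g z)%E ->
  (\int[P]_t g (X t, Y t) = \int[P]_u \int[P]_v g (X u, Y v))%E.
Proof.
move=> mX mY XY mg g0.
pose X' : {mfun T >-> T1} := mfun_Sub (mem_set mX).
pose Y' : {mfun T >-> T2} := mfun_Sub (mem_set mY).
have mZ : measurable_fun setT (fun t => (X t, Y t)) by exact/measurable_fun_pair.
pose Z : {mfun T >-> (T1 * T2)%type} := mfun_Sub (mem_set mZ).
rewrite -(ge0_integral_distribution (P := P) Z mg g0).
transitivity (\int[distribution P X' \x distribution P Y']_z g z)%E.
  apply: eq_measure_integral => /= A mA _; apply/esym.
  exact: product_measure_unique.
have H := @fubini_tonelli1 _ _ _ _ _ (distribution P X') (distribution P Y') g mg g0; rewrite H ge0_integral_distribution//=; last 2 first.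
- exact: measurable_fun_fubini_tonelli_F.
- by move=> y; apply: integral_ge0.
apply: eq_integral => u _ /=; rewrite /fubini_F.
rewrite -(ge0_integral_distribution Y' (f:= fun y => g (X u, y)))//.
exact: measurableT_comp mg (pair1_measurable _).
Qed.

Lemma integral_indep2M (X Y : T -> R) :
  P.-integrable setT (EFin \o X) -> P.-integrable setT (EFin \o Y) ->
  indep2 X Y ->
  P.-integrable setT (EFin \o (fun t => X t * Y t)) /\
  \int[P]_t (X t * Y t) = (\int[P]_t X t) * \int[P]_t Y t.
Proof.
move=> iX iY XY.
have /measurable_EFinP mX := measurable_int _ iX.
have /measurable_EFinP mY := measurable_int _ iY.
have iXY : P.-integrable setT (EFin \o (fun t => X t * Y t)).
  apply/integrableP; split.
    by apply/measurable_EFinP; exact: measurable_funM.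
  rewrite (indep2_Tonelli (X := X) (Y := Y)
    (g := fun z => `|(z.1 * z.2)%:E|%E))//; last first.
    apply/measurableT_comp => //; apply/measurable_EFinP.
    by apply: measurable_funM; [exact: measurable_fst|exact: measurable_snd].
  rewrite (eq_integral (fun u => `|(X u)%:E| * \int[P]_v `|(Y v)%:E|)%E); last first.
    move=> u _ /=; rewrite -ge0_integralZl//.
    - by apply: eq_integral => v _; rewrite normrM EFinM.
    - by apply/measurable_EFinP/measurableT_comp.
  rewrite ge0_integralZr//=; last 2 first.
  - by apply/measurable_EFinP/measurableT_comp.
  - exact: integral_ge0.
  move/integrableP : iX => [_ iX']; move/integrableP: iY => [_ iY'].
  by rewrite lte_mul_pinfty ?integral_ge0// ge0_fin_numE ?integral_ge0.
split=> //.
pose X' : {mfun T >-> R} := mfun_Sub (mem_set mX).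
pose Y' : {mfun T >-> R} := mfun_Sub (mem_set mY).
have mZ : measurable_fun setT (fun t => (X t, Y t)) by exact/measurable_fun_pair.
pose Z : {mfun T >-> (R * R)%type} := mfun_Sub (mem_set mZ).
have mM : measurable_fun setT (fun z : R * R => (z.1 * z.2)%:E).
  apply/measurable_EFinP.
  by apply: measurable_funM; [exact: measurable_fst|exact: measurable_snd].
rewrite /Rintegral -fineM; [|exact: integrable_fin_num|exact: integrable_fin_num].
congr fine.
rewrite -(integral_distribution (P := P) (X := Z) mM)//.
have pE (A : set (R * R)) : measurable A -> A `<=` setT ->
   distribution P Z A = (distribution P X' \x distribution P Y')%E A.
  move=> mA _; apply/esym.
  exact: product_measure_unique.
have iM : (distribution P X' \x distribution P Y')%E.-integrable setT
    (fun z : R * R => (z.1 * z.2)%:E).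
  apply/integrableP; split=> //.
  rewrite -(eq_measure_integral _ pE).
  rewrite (ge0_integral_distribution (P := P) Z)//.
    by move/integrableP : iXY => [].
  exact: measurableT_comp.
rewrite (eq_measure_integral _ pE) -integral12_prod_meas1//.
rewrite /fubini_F/=.
have fY := integrable_fin_num measurableT iY.
have eY x : (\int[distribution P Y']_y (x * y)%:E = x%:E * \int[P]_t (Y t)%:E)%E.
  rewrite integral_distribution//=.
  - by rewrite -integralZl.
  - by apply/measurable_EFinP; exact: measurable_funM.
  - exact: (integrableZl _ x iY).
under eq_integral do rewrite eY -(fineK fY).
rewrite integralZr//; last first.
  apply: integrable_pushforward => //.
by rewrite integral_distribution// fineK.
Qed.
End indep.

Section noise.
Context d (T : measurableType d) (R : realType) (P : probability T R).
Variable xi : nat -> {RV P >-> R}.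
Hypothesis indep : independent_noise xi.

(** The events that constrain each xi_j, j in J, separately form a pi-system which
generates the sigma-algebra of (xi_j), j in J. On this pi-system the measure
P restricted to {xi_i in A} is a multiple of P, hence so it is on the whole
sigma-algebra, which contains every event about the sum. *)
Lemma indep2_noise_sum (h : nat -> R -> R) (i : nat) (J : seq nat) :
  (forall j, measurable_fun setT (h j)) ->
  uniq (i :: J) -> {in i :: J, forall j, (0 < j)%N} ->
  indep2 P (xi i) (fun t => \sum_(j <- J) h j (xi j t)).
Proof.
move=> mh /[dup] uiJ /= /andP[iJ uJ] J0.
pose cyl (E : nat -> set R) : set T := \bigcap_(j in [set` J]) (xi j @^-1` E j).
pose G : set (set T) :=
  [set S | exists2 E : nat -> set R, forall j, measurable (E j) & S = cyl E].
have mpre (E : set R) j : measurable E -> measurable (xi j @^-1` E).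
  by move=> mE; rewrite -[X in measurable X]setTI; exact: measurable_funP.
have GT : G setT.
  exists (fun=> setT) => //; apply/seteqP; split => // t _ j _.
have GI : setI_closed G.
  move=> _ _ [E mE ->] [F mF ->]; exists (fun j => E j `&` F j).
    by move=> j; exact: measurableI.
  rewrite /cyl -bigcapI; apply: eq_bigcapr => j _.
  by rewrite preimage_setI.
have Gm : G `<=` measurable.
  move=> _ [E mE ->]; apply: fin_bigcap_measurable => // j _.
  exact: mpre.
move=> A B mA mB.
set S := fun t => _.
have mA' := mpre A i mA.
have PA : P (xi i @^-1` A) = (fine (P (xi i @^-1` A)))%:E.
  by rewrite fineK// fin_num_measure.
have PA0 : 0 <= fine (P (xi i @^-1` A)) by rewrite fine_ge0.
have sG : <<s G >> (S @^-1` B).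
  have mxi j : j \in J -> measurable_fun (setT : set (g_sigma_algebraType G)) (xi j).
    move=> jJ _ E mE; rewrite setTI; apply: sub_sigma_algebra.
    exists (fun k => if k == j then E else setT).
      by move=> k; case: ifP.
    apply/seteqP; split => [t Et k _ /=|t /(_ j jJ)/=]; last by rewrite eqxx.
    by case: eqP => // ->.
  have mS : measurable_fun (setT : set (g_sigma_algebraType G)) S.
    have -> : S = fun t => \sum_(j <- J) if j \in J then h j (xi j t) else 0.
      by apply/funext => t; rewrite /S big_seq big_mkcond.
    apply: measurable_sum => j; case: (boolP (j \in J)) => jJ //.
    by apply: measurableT_comp; [exact: mh|exact: mxi].
  have := mS measurableT B mB.
  by rewrite setTI.
pose m2 := mscale (NngNum PA0) P.
have cover : \bigcup_(k : nat) [set: T] = setT.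
  by apply/seteqP; split => // t _; exists 0%N.
have E12 S0 : G S0 -> mrestr P mA' S0 = m2 S0.
  move=> [E mE ->]; rewrite /mrestr /m2 /mscale /= -PA.
  have -> : cyl E = \bigcap_(j in [set` J]) (xi j @^-1` E j) by [].
  rewrite indep//; last by move=> j jJ; apply: J0; rewrite inE jJ orbT.
  pose E' j := if j == i then A else E j.
  have E'J j : j \in J -> E' j = E j.
    by rewrite /E'; case: eqP => // -> iJ'; rewrite iJ' in iJ.
  have E'i : E' i = A by rewrite /E' eqxx.
  have := indep uiJ J0 (E := E').
  rewrite big_cons E'i (eq_big_seq (fun j => P (xi j @^-1` E j))); last first.
    by move=> j jJ; rewrite E'J.
  move=> <-; last by move=> j; rewrite /E'; case: ifP.
  congr (P _); apply/seteqP; split => [t [H Ht] j /=|t H].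
    by rewrite inE => /predU1P[->|jJ]; [rewrite E'i|rewrite E'J//; exact: H].
  split; last by have := H i; rewrite /= inE eqxx E'i; apply.
  by move=> j jJ; have := H j; rewrite /= inE jJ orbT E'J//; apply.
have H : mrestr P mA' (S @^-1` B) = m2 (S @^-1` B).
  apply: (@g_sigma_algebra_measure_unique _ _ _ G Gm (fun=> setT) (fun=> GT) cover _ m2 GI E12) => // _.
  by rewrite /= /mrestr setTI PA ltry.
by rewrite setIC [RHS](_ : _ = m2 (S @^-1` B))// /m2 /mscale /= -PA.
Qed.
End noise.

(** * The Gaussian distribution function and Stein's equation *)

Section gauss.
Context {R : realType}.
Local Notation mu := (@lebesgue_measure R).

Definition phi (z : R) : R := (Num.sqrt (2 * pi))^-1 * expR (- z ^+ 2 / 2).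

Lemma normal_pdf01 : normal_pdf 0 1 = phi.
Proof.
apply/funext => z; rewrite normal_pdfE ?oner_neq0// /phi.
rewrite /normal_peak /normal_fun.
rewrite expr1n mul1r subr0; congr ((Num.sqrt _)^-1 * expR (_ / _)).
by rewrite mulr_natl.
Qed.

Lemma phi_gt0 z : 0 < phi z.
Proof. by rewrite /phi mulr_gt0 ?expR_gt0// invr_gt0 sqrtr_gt0 mulr_gt0// pi_gt0. Qed.

Lemma integrable_phi (D : set R) : measurable D -> mu.-integrable D (EFin \o phi).
Proof.
move=> mD; apply: (integrableS measurableT) => //.
by rewrite -normal_pdf01; exact: integrable_normal_pdf.
Qed.

Lemma PhiE (z : R) : Phi z = \int[mu]_(t in `]-oo, z]) phi t.
Proof.
have c0 : (Num.sqrt (2 * pi))^-1 != 0 :> R.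
  by rewrite invr_eq0 gt_eqF// sqrtr_gt0 mulr_gt0// pi_gt0.
have eE t : expR (- t ^+ 2 / 2) = Num.sqrt (2 * pi) * phi t.
  by rewrite /phi mulrA divff ?mul1r// -invr_eq0.
rewrite /Phi; under eq_Rintegral do rewrite eE.
rewrite [X in _ * X](_ : _ = Num.sqrt (2 * pi) * \int[mu]_(x in `]-oo, z]) phi x).
  by rewrite mulrA mulVf ?mul1r// -invr_eq0.
have mI := measurable_itv `]-oo, z]%R.
by apply: RintegralZl => //; exact: integrable_phi.
Qed.

Lemma Phi_normal_prob (z : R) : (Phi z)%:E = normal_prob 0 1 `]-oo, z].
Proof.
rewrite PhiE /Rintegral fineK; last first.
  by apply: integrable_fin_num => //; exact: integrable_phi.
by rewrite /normal_prob normal_pdf01.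
Qed.

Lemma Phi_ge0 (z : R) : 0 <= Phi z.
Proof. by rewrite -lee_fin Phi_normal_prob. Qed.

Lemma Phi_le1 (z : R) : Phi z <= 1.
Proof. by rewrite -lee_fin Phi_normal_prob probability_le1. Qed.

Lemma cdf_Phi (X : {RV (normal_prob (0 : R) 1 : probability (measurableTypeR R) R) >-> R}) : (forall t, X t = t) ->
  cdf X = EFin \o @Phi R.
Proof.
move=> Xt; apply/funext => z /=; rewrite Phi_normal_prob /cdf /distribution /pushforward.
by congr normal_prob; apply/seteqP; split=> t /=; rewrite Xt.
Qed.

Let idR : measurableTypeR R -> R := idfun.
#[local] HB.instance Definition _ :=
  @isMeasurableFun.Build _ _ _ _ idR (@measurable_id _ _ setT).

Lemma exists_idRV : exists X : {RV (normal_prob (0 : R) 1 : probability (measurableTypeR R) R) >-> R},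
 forall t, X t = t.
Proof. by exists (idR : {RV normal_prob (0 : R) 1 >-> R}). Qed.

Lemma Phi_cvgy : Phi z @[z --> +oo] --> (1 : R).
Proof.
have [X Xt] := exists_idRV.
by have := cvg_cdfy1 X; rewrite cdf_Phi// => /fine_cvg.
Qed.

Lemma Phi_cvgNy : Phi z @[z --> -oo] --> (0 : R).
Proof.
have [X Xt] := exists_idRV.
by have := cvg_cdfNy0 X; rewrite cdf_Phi// => /fine_cvg.
Qed.

Lemma is_derive_Phi (z : R) : is_derive z 1 (@Phi R) (phi z).
Proof.
have -> : @Phi R = fun z => \int[mu]_(t in `]-oo, z]) phi t.
  by apply/funext => t; rewrite PhiE.
have [] := @continuous_FTC1 R phi -oo%O z (z + 1) _ (integrable_phi (measurable_itv _)) _ _.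
- by rewrite ltrDl.
- by rewrite ltNyr.
- by have := @continuous_normal_pdf R 0 1 (oner_neq0 _) z; rewrite normal_pdf01.
- by move=> dPhi; rewrite derive1E => <-; exact: derivableP.
Qed.

Lemma is_derive1M (f g : R -> R) (x a b : R) : is_derive x 1 f a -> is_derive x 1 g b ->
  is_derive x 1 (fun t => f t * g t) (a * g x + f x * b).
Proof.
move=> df dg; apply: is_derive_eq (is_deriveM df dg) _.
by rewrite /GRing.scale/= addrC mulrC.
Qed.

Lemma is_derive1D (f g : R -> R) (x a b : R) : is_derive x 1 f a -> is_derive x 1 g b ->
  is_derive x 1 (fun t => f t + g t) (a + b).
Proof. by move=> df dg; exact: is_deriveD. Qed.

Lemma is_derive1Z (f : R -> R) (k x a : R) : is_derive x 1 f a ->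
  is_derive x 1 (fun t => k * f t) (k * a).
Proof. by move=> df; exact: is_deriveZ. Qed.

Lemma is_derive1Nid (f : R -> R) (x a : R) : is_derive (- x) 1 f a ->
  is_derive x 1 (fun t => f (- t)) (- a).
Proof.
move=> df; apply: is_derive_eq (is_derive1_comp df (is_deriveNid x 1)) _.
by rewrite mulrN1.
Qed.

Lemma is_derive1_expR_sqr (c z : R) :
  is_derive z 1 (fun t => expR (c * t ^+ 2)) (expR (c * z ^+ 2) * (c * (2 * z))).
Proof.
have h : is_derive z 1 (fun t => c * t ^+ 2) (c * (2 * z)).
  apply: is_derive1Z; apply: is_derive_eq (is_derive1M (is_derive_id z 1) (is_derive_id z 1)) _.
  by rewrite mul1r mulr1 mulr_natl.
exact: (@is_derive1_comp R expR (fun t => c * t ^+ 2) z _ _ (is_derive_expR (c * z ^+ 2)) h).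
Qed.

Lemma is_derive_phi (z : R) : is_derive z 1 phi (- z * phi z).
Proof.
have -> : phi = fun t => (Num.sqrt (2 * pi))^-1 * expR (- (2^-1) * t ^+ 2).
  by apply/funext => t; rewrite /phi mulrC [_ / 2]mulrC mulrN mulNr [RHS]mulrC.
apply: is_derive_eq (is_derive1Z _ (is_derive1_expR_sqr _ _)) _.
set u := (Num.sqrt _)^-1; set e := expR _; field.
by [].
Qed.

Lemma MVT_le (F dF : R -> R) (a b : R) : a <= b ->
  (forall u, a <= u <= b -> is_derive u 1 F (dF u)) ->
  exists2 c, a <= c <= b & F b - F a = dF c * (b - a).
Proof.
move=> ab dFu.
have [||c] := @MVT_segment R F dF a b ab.
- by move=> u; rewrite in_itv/= => /andP[au ub]; apply: dFu; rewrite !ltW.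
- apply: derivable_within_continuous => u; rewrite in_itv/= => uab.
  by have [] := dFu _ uab.
- by rewrite in_itv/=; exists c.
Qed.

Lemma PhiN (z : R) : Phi (- z) = 1 - Phi z.
Proof.
pose D t := Phi t + Phi (- t) : R.
have phiN t : phi (- t) = phi t :> R by rewrite /phi sqrrN.
have dD (t : R) : is_derive t 1 D 0.
  apply: is_derive_eq (is_derive1D (is_derive_Phi t) (is_derive1Nid (is_derive_Phi (- t)))) _.
  by rewrite phiN subrr.
have Dc a b : a <= b -> D a = D b.
  move=> ab; have [c _] := MVT_le ab (fun u _ => dD u).
  by rewrite mul0r => /eqP; rewrite subr_eq0 => /eqP.
have D0 t : D t = D 0 by have [/Dc//|/ltW/Dc//] := leP t 0.
have D1 : D 0 = 1.
  have : D t @[t --> +oo] --> (1 + 0 : R).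
    apply: cvgD; first exact: Phi_cvgy.
    apply: (@cvg_comp _ _ _ (-%R) (@Phi R)) Phi_cvgNy.
    by rewrite -ninfty.
  rewrite addr0 => /cvg_lim <-//.
  apply/esym/cvg_lim => //; rewrite (_ : D = fun=> D 0); first exact: cvg_cst.
  by apply/funext => t; rewrite D0.
by have := D0 z; rewrite D1 /D => <-; ring.
Qed.

Lemma Phi_ndecr (a b : R) : a <= b -> Phi a <= Phi b.
Proof.
move=> ab; have [c _] := MVT_le ab (fun u _ => is_derive_Phi u).
by move=> /eqP; rewrite subr_eq => /eqP ->; rewrite lerDr mulr_ge0 ?subr_ge0// ltW// phi_gt0.
Qed.

Lemma Phi_lipschitz (a b : R) : a <= b -> Phi b - Phi a <= b - a.
Proof.
move=> ab; have [c _ ->] := MVT_le ab (fun u _ => is_derive_Phi u).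
rewrite ler_piMl ?subr_ge0// /phi mulr_ile1 ?expR_ge0 ?invr_ge0 ?sqrtr_ge0//.
  rewrite invr_le1 ?unitfE ?gt_eqF// ?sqrtr_gt0 ?mulr_gt0 ?pi_gt0//.
  rewrite -[leLHS]sqrtr1 ler_wsqrtr//.
  have := @pi_ge2 R; lra.
by rewrite -expR0 ler_expR mulr_le0_ge0 ?oppr_le0 ?sqr_ge0.
Qed.

(** The derivative of w |-> - z Phi w - phi w is (w - z) phi w, so this function
decreases on the left of z, where it starts from its limit 0 at -oo. *)
Lemma Phi_tail (z : R) : z <= 0 -> - z * Phi z <= phi z.
Proof.
move=> z0; pose k w : R := - z * Phi w + -1 * phi w.
have dk (w : R) : is_derive w 1 k ((w - z) * phi w).
  apply: is_derive_eq (is_derive1D (is_derive1Z (- z) (is_derive_Phi w))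
    (is_derive1Z (-1) (is_derive_phi w))) _.
  ring.
have kz w : w <= z -> k z <= - z * Phi w.
  move=> wz; have [c /andP[wc cz]] := MVT_le wz (fun u _ => dk u).
  move=> /eqP; rewrite subr_eq => /eqP ->.
  rewrite {1}/k.
  have : (c - z) * phi c * (z - w) <= 0.
    by rewrite mulr_le0_ge0 ?subr_ge0// mulr_le0_ge0 ?subr_le0// ltW// phi_gt0.
  by have := phi_gt0 w; lra.
have : - z * Phi w @[w --> -oo] --> - z * (0 : R).
  by apply: cvgMr; exact: Phi_cvgNy.
rewrite mulr0 => /cvgr_to_ge H.
have : k z <= 0.
  apply: H; near=> w; apply: kz; near: w.
  by apply: nbhs_ninfty_le; rewrite num_real.
by rewrite /k mulN1r subr_le0.
Unshelve. all: by end_near. Qed.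

(** The reciprocal of [phi]. *)
Definition ephi (z : R) : R := Num.sqrt (2 * pi) * expR (2^-1 * z ^+ 2).
Definition mills (z : R) : R := Phi z * ephi z.

Lemma phiK (z : R) : phi z * ephi z = 1.
Proof.
have s0 : Num.sqrt (2 * pi) != 0 :> R.
  by rewrite gt_eqF// sqrtr_gt0 mulr_gt0// pi_gt0.
rewrite /phi /ephi mulrACA mulVf// mul1r -expRD -[RHS]expR0; congr expR.
by field.
Qed.

Lemma ephi_gt0 z : 0 < ephi z.
Proof. by rewrite /ephi mulr_gt0 ?expR_gt0// sqrtr_gt0 mulr_gt0// pi_gt0. Qed.

Lemma ephiN z : ephi (- z) = ephi z.
Proof. by rewrite /ephi sqrrN. Qed.

Lemma mills_ge0 z : 0 <= mills z.
Proof. by rewrite mulr_ge0 ?Phi_ge0// ltW// ephi_gt0. Qed.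

Lemma is_derive_mills (z : R) : is_derive z 1 mills (1 + z * mills z).
Proof.
have de : is_derive z 1 ephi (z * ephi z).
  apply: is_derive_eq (is_derive1Z _ (is_derive1_expR_sqr _ _)) _.
  by rewrite /ephi; set u := Num.sqrt _; set e := expR _; field.
apply: is_derive_eq (is_derive1M (is_derive_Phi z) de) _.
by rewrite phiK /mills; ring.
Qed.

Lemma mills_tail z : z <= 0 -> - z * mills z <= 1.
Proof.
move=> z0; rewrite -(phiK z) /mills mulrA ler_wpM2r ?Phi_tail// ltW//.
exact: ephi_gt0.
Qed.

Lemma mills_le0 z : z <= 0 -> mills z <= mills 0.
Proof.
move=> z0.
have [c /andP[zc c0]] := MVT_le z0 (fun u _ => is_derive_mills u).
move=> /eqP; rewrite subr_eq => /eqP ->.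
rewrite lerDr mulr_ge0 ?subr_ge0//.
by have := mills_tail c0; lra.
Qed.

Lemma millsM_PhiN z : mills z * Phi (- z) = mills (- z) * Phi z.
Proof. by rewrite /mills ephiN; ring. Qed.

(** The bounded solution g of Stein's equation g'(w) - w g(w) = 1(w <= z) - Phi z. *)
Definition stein (z w : R) : R :=
  if w <= z then mills w * Phi (- z) else mills (- w) * Phi z.

(** The derivative of [stein z], with the value that Stein's equation prescribes
at the kink w = z. *)
Definition dstein (z w : R) : R := w * stein z w + (w <= z)%R%:R - Phi z.

Lemma stein_ge0 z w : 0 <= stein z w.
Proof. by rewrite /stein; case: ifP => _; rewrite mulr_ge0 ?mills_ge0 ?Phi_ge0. Qed.

(** By monotonicity of Phi, z can be replaced by w in the bounded factor of
either branch; the two branches then agree by [millsM_PhiN], and the larger of w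
and - w can be moved into that factor. *)
Lemma stein_le z w : stein z w <= mills (- `|w|).
Proof.
rewrite /stein; have [wz|zw] := leP w z.
- have [w0|w0] := leP w 0.
    by rewrite ler0_norm// opprK ler_piMr ?mills_ge0 ?Phi_le1.
  rewrite gtr0_norm//.
  rewrite (@le_trans _ _ (mills w * Phi (- w)))//.
    by rewrite ler_wpM2l ?mills_ge0// Phi_ndecr// lerN2.
  by rewrite millsM_PhiN ler_piMr ?mills_ge0 ?Phi_le1.
- have [w0|w0] := leP w 0; last first.
    by rewrite gtr0_norm// ler_piMr ?mills_ge0 ?Phi_le1.
  rewrite ler0_norm// opprK.
  rewrite (@le_trans _ _ (mills (- w) * Phi w))//.
    by rewrite ler_wpM2l ?mills_ge0// Phi_ndecr// ltW.
  by rewrite -millsM_PhiN ler_piMr ?mills_ge0 ?Phi_le1.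
Qed.

Lemma stein_bound z w : stein z w <= mills 0.
Proof. by apply: le_trans (stein_le _ _) (mills_le0 _); rewrite oppr_le0. Qed.

Lemma normM_stein z w : `|w * stein z w| <= 1.
Proof.
rewrite normrM (ger0_norm (stein_ge0 _ _)).
have := @mills_tail (- `|w|); rewrite oppr_le0 opprK => /(_ (normr_ge0 _)).
by apply: le_trans; rewrite ler_wpM2l// stein_le.
Qed.

Lemma dstein_bound z w : `|dstein z w| <= 2.
Proof.
have := normM_stein z w; rewrite /dstein !ler_norml => /andP[h1 h2].
have := Phi_ge0 z; have := Phi_le1 z => p1 p0.
by case: (w <= z) => /=; lra.
Qed.

(** Truncating the arguments at z by min and max turns the two branches into a
single sum, since both take the same value at z. *)
Lemma continuous_stein z : continuous (stein z).
Proof.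
have cm : continuous mills.
  move=> w; apply: differentiable_continuous; apply/derivable1_diffP.
  by have [] := is_derive_mills w.
have -> : stein z = fun w => mills (Num.min w z) * Phi (- z)
    + mills (- Num.max w z) * Phi z - mills z * Phi (- z).
  apply/funext => w; rewrite /stein /Num.min /Num.max.
  have [wz|zw|->] := ltgtP w z.
  - by rewrite -millsM_PhiN; ring.
  - ring.
  - by rewrite -millsM_PhiN; ring.
have c1 : continuous (fun w => mills (Num.min w z)).
  move=> w; apply: (@continuous_comp _ _ _ (fun x : R => Num.min x z) mills); last exact: cm.
  by apply: continuous_min; [exact: cvg_id|exact: cvg_cst].
have c2 : continuous (fun w => mills (- Num.max w z)).
  move=> w; apply: (@continuous_comp _ _ _ (fun x : R => - Num.max x z) mills); last exact: cm.
  apply: cvgN.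
  by apply: continuous_max; [exact: cvg_id|exact: cvg_cst].
move=> w; apply: cvgB; last exact: cvg_cst.
by apply: cvgD; apply: cvgMl; [exact: c1|exact: c2].
Qed.

Lemma is_derive_stein (z w : R) : w != z -> is_derive w 1 (stein z) (dstein z w).
Proof.
rewrite neq_lt => /orP[wz|zw].
- apply: (near_eq_is_derive (f := fun t => Phi (- z) * mills t)).
    near=> t; have tz : t <= z by apply/ltW; near: t; exact: lt_nbhsl.
    by rewrite /stein tz mulrC.
  apply: is_derive_eq (is_derive1Z _ (is_derive_mills w)) _.
  by rewrite /dstein /stein (ltW wz) PhiN /=; ring.
- apply: (near_eq_is_derive (f := fun t => Phi z * mills (- t))).
    near=> t; have tz : z < t by near: t; exact: lt_nbhsr.
    by rewrite /stein leNgt tz mulrC.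
  apply: is_derive_eq (is_derive1Z _ (is_derive1Nid (is_derive_mills (- w)))) _.
  by rewrite /dstein /stein leNgt zw /=; ring.
Unshelve. all: by end_near. Qed.

(** The mean value theorem on either side of a kink, for use with [stein z]. *)
Lemma derive_lipschitz_off_point (F dF : R -> R) (z K : R) : continuous F ->
  (forall u, u != z -> is_derive u 1 F (dF u)) ->
  forall a b, a <= b -> (forall u, a < u < b -> `|dF u| <= K) ->
  `|F b - F a| <= K * (b - a).
Proof.
move=> cF dFu.
have base a b : a <= b -> ~~ (a < z < b) -> (forall u, a < u < b -> `|dF u| <= K) ->
    `|F b - F a| <= K * (b - a).
  rewrite le_eqVlt => /predU1P[->|ab] zab dFK; first by rewrite !subrr normr0 mulr0.
  have [||c] := @MVT R F dF a b ab.
  - move=> u; rewrite in_itv/= => uab; apply: dFu.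
    by apply/eqP => uz; move: zab; rewrite -uz uab.
  - exact: continuous_subspaceT.
  rewrite in_itv/= => cab ->.
  by rewrite normrM (gtr0_norm (_ : 0 < b - a)) ?subr_gt0// ler_wpM2r ?subr_ge0 ?dFK// ltW.
move=> a b ab dFK; have [/andP[az zb]|nz] := boolP (a < z < b); last exact: base.
have h1 : `|F z - F a| <= K * (z - a).
  apply: base; rewrite ?ltxx ?andbF// ?(ltW az)// => u /andP[au uz].
  by apply: dFK; rewrite au (lt_trans uz).
have h2 : `|F b - F z| <= K * (b - z).
  apply: base; rewrite ?ltxx// ?(ltW zb)// => u /andP[zu ub].
  by apply: dFK; rewrite ub (lt_trans az).
have -> : F b - F a = (F b - F z) + (F z - F a) by ring.
by apply: le_trans (ler_normD _ _) _; lra.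
Qed.

Lemma stein_lipschitz (z a b : R) : `|stein z b - stein z a| <= 2 * `|b - a|.
Proof.
have H (u v : R) : u <= v -> `|stein z v - stein z u| <= 2 * (v - u).
  move=> uv; apply: (derive_lipschitz_off_point (@continuous_stein z) (@is_derive_stein z)) => // t _.
  exact: dstein_bound.
have [ab|/ltW ba] := leP a b; first by rewrite (ger0_norm (_ : 0 <= b - a)) ?subr_ge0 ?H.
by rewrite distrC [`|b - a|]distrC (ger0_norm (_ : 0 <= a - b)) ?subr_ge0 ?H.
Qed.

Definition stein_cst : R := mills 0 + 2.
Definition min1 (x : R) : R := Num.min 1 `|x|.
(** A modulus of continuity of [dstein z] at w for increments of size at most
|x|: the first term accounts for w * stein z w, the indicator for the jump at z,
which is only felt when w is within |x| of z. *)
Definition stein_mod (z x w : R) : R :=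
  stein_cst * (`|w| + 1) * min1 x + (`|w - z| <= `|x|)%R%:R.

Lemma min1_ge0 x : 0 <= min1 x.
Proof. by rewrite /min1 le_min ler01 normr_ge0. Qed.

Lemma min1_le1 x : min1 x <= 1.
Proof. by rewrite /min1 ge_min lexx. Qed.

Lemma min1_homo x y : `|x| <= `|y| -> min1 x <= min1 y.
Proof. by move=> xy; rewrite /min1 le_min !ge_min lexx xy orbT. Qed.

Lemma stein_cst_ge2 : 2 <= stein_cst.
Proof. by rewrite /stein_cst lerDr mills_ge0. Qed.

Lemma stein_mod_ge0 z x w : 0 <= stein_mod z x w.
Proof.
rewrite addr_ge0// mulr_ge0 ?min1_ge0// mulr_ge0 ?addr_ge0//.
exact: mills_ge0.
Qed.

Lemma norm_mul_stein_sub (z w u : R) :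
  `|u * stein z u - w * stein z w| <= stein_cst * (`|w| + 1) * min1 (u - w).
Proof.
have K2 := stein_cst_ge2.
have w0 := normr_ge0 w.
rewrite /min1 /Num.min; case: ltP => uw.
  rewrite mulr1; apply: le_trans (ler_normB _ _) _.
  have := normM_stein z u; have := normM_stein z w => h1 h2.
  apply: (@le_trans _ _ 2); first lra.
  by rewrite -[leLHS]mulr1 ler_pM// lerDr.
have -> : u * stein z u - w * stein z w =
  (u - w) * stein z u + w * (stein z u - stein z w) by ring.
apply: le_trans (ler_normD _ _) _; rewrite !normrM.
apply: (@le_trans _ _ (`|u - w| * mills 0 + `|w| * (2 * `|u - w|))).
  rewrite lerD//; first by rewrite ler_wpM2l// ger0_norm ?stein_ge0 ?stein_bound.
  by rewrite ler_wpM2l// stein_lipschitz.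
rewrite mulrC [X in _ + X](_ : _ = 2 * `|w| * `|u - w|); last by ring.
rewrite -mulrDl ler_wpM2r// /stein_cst.
have := mills_ge0 0; nra.
Qed.

Lemma dstein_sub (z x w u : R) : `|u - w| <= `|x| ->
  `|dstein z u - dstein z w| <= stein_mod z x w.
Proof.
move=> uwx.
have -> : dstein z u - dstein z w = (u * stein z u - w * stein z w) +
   ((u <= z)%R%:R - (w <= z)%R%:R) by rewrite /dstein; ring.
apply: le_trans (ler_normD _ _) _; rewrite /stein_mod lerD//.
  apply: le_trans (norm_mul_stein_sub _ _ _) _.
  rewrite ler_wpM2l ?min1_homo// mulr_ge0 ?addr_ge0//.
  exact: mills_ge0.
have [h|h] := leP `|w - z| `|x|.
  by case: (u <= z); case: (w <= z); rewrite /= ?subrr ?sub0r ?subr0 ?normrN ?normr1 ?normr0.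
have [uz|uz] := leP u z; have [wz|wz] := leP w z; rewrite /= ?subrr ?normr0//.
- have : w - z <= `|u - w| by rewrite distrC; apply: le_trans (ler_norm _); lra.
  by move: h; rewrite (gtr0_norm (_ : 0 < w - z)) ?subr_gt0//; lra.
- have : z - w <= `|u - w| by apply: le_trans (ler_norm _); lra.
  by move: h; rewrite (ler0_norm (_ : w - z <= 0)) ?subr_le0//; lra.
Qed.

Lemma stein_taylor (z x w : R) :
  `|x * (stein z (w + x) - stein z w) - x ^+ 2 * dstein z w| <= x ^+ 2 * stein_mod z x w.
Proof.
pose F u := stein z u + - dstein z w * u.
pose dF u := dstein z u + - dstein z w.
have cF : continuous F.
  move=> u; apply: cvgD; first exact: continuous_stein.
  by apply: cvgMr; exact: cvg_id.
have dFu u : u != z -> is_derive u 1 F (dF u).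
  move=> uz; apply: is_derive_eq
    (is_derive1D (is_derive_stein uz) (is_derive1Z (- dstein z w) (is_derive_id u 1))) _.
  by rewrite mulr1.
have FE : x * (stein z (w + x) - stein z w) - x ^+ 2 * dstein z w = x * (F (w + x) - F w).
  by rewrite /F; ring.
rewrite FE normrM -real_normK ?num_real// expr2 -mulrA ler_wpM2l//.
have K a b : a <= b -> b - a = `|x| -> (w = a \/ w = b) ->
    `|F b - F a| <= stein_mod z x w * `|x|.
  move=> ab abx wab; rewrite -abx.
  apply: (derive_lipschitz_off_point cF dFu) => // u /andP[au ub].
  apply: dstein_sub; rewrite -abx.
  by case: wab => ->; [rewrite gtr0_norm|rewrite ltr0_norm]; rewrite ?subr_gt0 ?subr_lt0//; lra.
rewrite mulrC; have [x0|x0] := leP 0 x.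
  by apply: K; rewrite ?lerDl//; [rewrite ger0_norm//; ring|left].
rewrite distrC; apply: K; rewrite ?gerDl ?(ltW x0)//; [rewrite ltr0_norm//; ring|by right].
Qed.

End gauss.

(** * Expectations of real functions *)

Lemma measurable_natb d (T : measurableType d) (R : realType) (b : T -> bool) :
  measurable_fun setT b -> measurable_fun setT (fun t => (b t)%:R : R).
Proof.
move=> mb; rewrite (_ : (fun _ => _) = fun t => if b t then 1 else 0 : R).
  exact: measurable_fun_ifT.
by apply/funext => t; case: (b t).
Qed.

Lemma measurable_setb d (T : measurableType d) (b : T -> bool) :
  measurable_fun setT b -> measurable [set t | b t].
Proof.
move=> mb; rewrite (_ : [set t | b t] = setT `&` b @^-1` [set true]); first exact: mb.
by rewrite setTI; apply/seteqP; split => t.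
Qed.

Section expectation.
Context d (T : measurableType d) (R : realType) (P : probability T R).
Implicit Types f g : T -> R.

Definition L1 f := P.-integrable setT (EFin \o f).
Definition mean f : R := \int[P]_t f t.

Lemma L1_measurable f : L1 f -> measurable_fun setT f.
Proof. by move=> /measurable_int /measurable_EFinP. Qed.

Lemma L1_dom f g : measurable_fun setT f -> L1 g -> (forall t, `|f t| <= g t) -> L1 f.
Proof.
move=> mf ig fg; apply: le_integrable ig => //; first exact/measurable_EFinP.
move=> t _ /=; rewrite lee_fin; apply: le_trans (fg t) _.
exact: ler_norm.
Qed.

Lemma L1_cst (k : R) : L1 (fun=> k).
Proof. exact: finite_measure_integrable_cst. Qed.

Lemma L1_bounded f (k : R) : measurable_fun setT f -> (forall t, `|f t| <= k) -> L1 f.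
Proof. by move=> mf fk; exact: L1_dom (L1_cst k) fk. Qed.

Lemma L1D f g : L1 f -> L1 g -> L1 (fun t => f t + g t).
Proof. by move=> fi gi; exact: (integrableD measurableT fi gi). Qed.

Lemma L1B f g : L1 f -> L1 g -> L1 (fun t => f t - g t).
Proof. by move=> fi gi; exact: (integrableB measurableT fi gi). Qed.

Lemma L1Z k f : L1 f -> L1 (fun t => k * f t).
Proof. by move=> fi; exact: (integrableZl measurableT k fi). Qed.

Lemma L1_sum I (J : seq I) (F : I -> T -> R) :
  (forall j, L1 (F j)) -> L1 (fun t => \sum_(j <- J) F j t).
Proof.
move=> Fi; elim: J => [|j J IH].
  by under eq_fun do rewrite big_nil; exact: L1_cst.
by under eq_fun do rewrite big_cons; exact: L1D.
Qed.

Lemma meanD f g : L1 f -> L1 g -> mean (fun t => f t + g t) = mean f + mean g.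
Proof. exact: RintegralD. Qed.

Lemma meanB f g : L1 f -> L1 g -> mean (fun t => f t - g t) = mean f - mean g.
Proof. exact: RintegralB. Qed.

Lemma meanZ k f : L1 f -> mean (fun t => k * f t) = k * mean f.
Proof. exact: RintegralZl. Qed.

Lemma mean_cst k : mean (fun=> k) = k.
Proof. by rewrite /mean Rintegral_cst//= probability_setT mulr1. Qed.

Lemma mean_sum I (J : seq I) (F : I -> T -> R) : (forall j, L1 (F j)) ->
  mean (fun t => \sum_(j <- J) F j t) = \sum_(j <- J) mean (F j).
Proof.
move=> Fi; elim: J => [|j J IH].
  by rewrite big_nil -[RHS](mean_cst 0); congr mean; apply/funext => t; rewrite big_nil.
rewrite big_cons -IH -meanD//; last exact: L1_sum.
by congr mean; apply/funext => t; rewrite big_cons.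
Qed.

Lemma mean_le f g : L1 f -> L1 g -> (forall t, f t <= g t) -> mean f <= mean g.
Proof. by move=> fi gi fg; apply: le_Rintegral. Qed.

Lemma mean_ge0 f : (forall t, 0 <= f t) -> 0 <= mean f.
Proof. by move=> f0; apply: Rintegral_ge0. Qed.

Lemma norm_mean f : L1 f -> `|mean f| <= mean (fun t => `|f t|).
Proof. exact: le_normr_Rintegral. Qed.

Lemma L1_norm f : L1 f -> L1 (fun t => `|f t|).
Proof. by move=> fi; exact: integrable_norm. Qed.

Lemma mean_indic (A : set T) : measurable A -> mean \1_A = fine (P A).
Proof. by move=> mA; rewrite /mean /Rintegral integral_indic// setIT. Qed.

Lemma L1_natb (b : T -> bool) : measurable_fun setT b -> L1 (fun t => (b t)%:R).
Proof.
move=> mb; apply: (@L1_bounded _ 1); first exact: measurable_natb.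
by move=> t; case: (b t); rewrite ?normr1 ?normr0.
Qed.

Lemma mean_natb (b : T -> bool) : measurable_fun setT b ->
  mean (fun t => (b t)%:R) = fine (P [set t | b t]).
Proof.
move=> /measurable_setb mb; rewrite -mean_indic//; congr mean; apply/funext => t.
by rewrite indicE mem_setE.
Qed.

(** The Cauchy-Schwarz inequality, from 2 e |f| <= f ^ 2 + e ^ 2. *)
Lemma mean_norm_le_sqr f : measurable_fun setT f -> L1 (fun t => f t ^+ 2) ->
  forall e : R, 0 < e -> mean (fun t => f t ^+ 2) <= e ^+ 2 -> mean (fun t => `|f t|) <= e.
Proof.
move=> mf f2 e e0 fe.
have H t : `|f t| <= (2 * e)^-1 * f t ^+ 2 + e / 2.
  rewrite -real_normK ?num_real//; set u := `|f t|.
  rewrite -subr_ge0 (_ : _ - _ = (2 * e)^-1 * (u - e) ^+ 2).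
    by rewrite mulr_ge0 ?sqr_ge0// invr_ge0 ltW// mulr_gt0.
  by field; rewrite gt_eqF.
have iH : L1 (fun t => (2 * e)^-1 * f t ^+ 2 + e / 2).
  by apply: L1D; [exact: L1Z|exact: L1_cst].
apply: (@le_trans _ _ (mean (fun t => (2 * e)^-1 * f t ^+ 2 + e / 2))).
  apply: mean_le => //; apply: L1_dom iH _ => //.
    exact: measurableT_comp.
  by move=> t; rewrite normr_id.
rewrite meanD; [|exact: L1Z|exact: L1_cst].
rewrite (meanZ _ f2) mean_cst.
apply: (@le_trans _ _ ((2 * e)^-1 * e ^+ 2 + e / 2)).
  by rewrite lerD2r ler_wpM2l// invr_ge0 ltW// mulr_gt0.
by rewrite le_eqVlt; apply/orP; left; apply/eqP; field; rewrite gt_eqF.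
Qed.

Lemma mean_sqr_sum (J : seq nat) (Y : nat -> T -> R) : uniq J ->
  (forall i, L1 (fun t => Y i t ^+ 2)) ->
  (forall i j, i != j -> L1 (fun t => Y i t * Y j t) /\ mean (fun t => Y i t * Y j t) = 0) ->
  L1 (fun t => (\sum_(j <- J) Y j t) ^+ 2) /\
  mean (fun t => (\sum_(j <- J) Y j t) ^+ 2) = \sum_(j <- J) mean (fun t => Y j t ^+ 2).
Proof.
move=> uJ iY2 YY; elim: J uJ => [_|i J IH /= /andP[iJ /IH[iJ2 EJ]]].
  have -> : (fun t => (\sum_(j <- [::]) Y j t) ^+ 2) = fun=> 0.
    by apply/funext => t; rewrite big_nil expr0n.
  by rewrite mean_cst big_nil; split=> //; exact: L1_cst.
have -> : (fun t => (\sum_(j <- i :: J) Y j t) ^+ 2) = fun t => Y i t ^+ 2 +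
    (\sum_(j <- J) (if j == i then 0 else 2 * (Y i t * Y j t)) + (\sum_(j <- J) Y j t) ^+ 2).
  apply/funext => t; rewrite big_cons sqrrD -addrA; congr (_ + (_ + _)).
  rewrite -mulr_natl mulrA mulr_sumr; apply: eq_big_seq => j jJ.
  by case: eqP => [ji|_]; [rewrite -ji jJ in iJ|rewrite mulrA].
have iC j : L1 (fun t => if j == i then 0 else 2 * (Y i t * Y j t)).
  have [ji|ji] := eqVneq j i; first exact: L1_cst.
  by apply: L1Z; have [] := YY i j; rewrite // eq_sym.
have iS : L1 (fun t => \sum_(j <- J) (if j == i then 0 else 2 * (Y i t * Y j t))).
  exact: (@L1_sum _ J (fun j t => if j == i then 0 else 2 * (Y i t * Y j t))).
split; first by apply: L1D => //; apply: L1D.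
rewrite meanD ?meanD//; last exact: L1D.
rewrite (@mean_sum _ J (fun j t => if j == i then 0 else 2 * (Y i t * Y j t)))//.
rewrite EJ big1 ?add0r ?big_cons// => j _.
have [ji|ji] := eqVneq j i; first by rewrite mean_cst.
by have [|iYY EYY] := YY i j; [rewrite eq_sym|rewrite meanZ// EYY mulr0].
Qed.

Lemma mean_indep2M f g : L1 f -> L1 g -> indep2 P f g ->
  L1 (fun t => f t * g t) /\ mean (fun t => f t * g t) = mean f * mean g.
Proof. exact: integral_indep2M. Qed.

Lemma measurable_integral_snd d1 d2 (T1 : measurableType d1) (T2 : measurableType d2)
    (Y : T -> T2) (g : T1 * T2 -> \bar R) :
  measurable_fun setT Y -> measurable_fun setT g -> (forall z, 0 <= g z)%E ->
  measurable_fun setT (fun x => \int[P]_v g (x, Y v))%E.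
Proof.
move=> mY mg g0; pose Y' : {mfun T >-> T2} := mfun_Sub (mem_set mY).
have := @measurable_fun_fubini_tonelli_F _ _ T1 T2 R (distribution P Y') g mg g0.
rewrite /fubini_F; apply: eq_measurable_fun => x _ /=.
rewrite (ge0_integral_distribution Y' (f := fun y => g (x, y)))//.
exact: measurableT_comp mg (pair1_measurable _).
Qed.

(** Conditioning on X in the form of Tonelli's theorem: a bound on the mean of
h x Y for frozen x may depend on x and is integrated afterwards. *)
Lemma mean_indep2_le (X Y : T -> R) (h : R -> R -> R) (k : R -> R) :
  measurable_fun setT X -> measurable_fun setT Y -> indep2 P X Y ->
  measurable_fun setT (fun z : R * R => h z.1 z.2) -> (forall x y, 0 <= h x y) ->
  L1 (fun t => k (X t)) -> (forall x, L1 (fun t => h x (Y t))) ->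
  (forall x, mean (fun t => h x (Y t)) <= k x) ->
  L1 (fun t => h (X t) (Y t)) /\ mean (fun t => h (X t) (Y t)) <= mean (fun t => k (X t)).
Proof.
move=> mX mY XY mh h0 ik ih hk.
have mXY : measurable_fun setT (fun t => h (X t) (Y t)).
  exact: (measurableT_comp mh (measurable_fun_pair mX mY)).
have E : (\int[P]_t (h (X t) (Y t))%:E <= \int[P]_t (k (X t))%:E)%E.
  rewrite (indep2_Tonelli (g := fun z => (h z.1 z.2)%:E) mX mY XY)//; last 2 first.
  - by apply/measurable_EFinP.
  - by move=> z; rewrite lee_fin.
  have hkE u : (\int[P]_v (h (X u) (Y v))%:E <= (k (X u))%:E)%E.
    rewrite -[leLHS]fineK; first by rewrite lee_fin; exact: hk.
    exact: (integrable_fin_num measurableT (ih (X u))).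
  apply: ge0_le_integral => //=.
  - by move=> u _; apply: integral_ge0 => v _; rewrite lee_fin.
  - have mF := measurable_integral_snd (g := fun z => (h z.1 z.2)%:E) mY.
    apply: (measurableT_comp (mF _ _) mX); first exact/measurable_EFinP.
    by move=> z; rewrite lee_fin.
  - exact: measurable_int ik.
have ih' : L1 (fun t => h (X t) (Y t)).
  apply/integrableP; split; first exact/measurable_EFinP.
  rewrite (eq_integral (fun t => (h (X t) (Y t))%:E)).
    by apply: le_lt_trans E (integrable_lty measurableT ik).
  by move=> t _ /=; rewrite ger0_norm.
split=> //; rewrite /mean /Rintegral fine_le//.
- exact: integrable_fin_num.
- exact: integrable_fin_num.
Qed.

(** * Concentration of sums of independent variables *)

Section concentration.
Variable X : nat -> T -> R.
Hypothesis mX : forall i, measurable_fun setT (X i).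
Hypothesis iX2 : forall i, L1 (fun t => X i t ^+ 2).
Hypothesis X0 : forall i, mean (X i) = 0.
Hypothesis indep : forall i J, uniq (i :: J) ->
  indep2 P (X i) (fun t => \sum_(j <- J) X j t).

Let iX i : L1 (X i).
Proof.
have iH : L1 (fun t => 1 + X i t ^+ 2) by apply: L1D => //; exact: L1_cst.
apply: L1_dom iH _ => // t.
rewrite -[X in _ <= 1 + X]real_normK ?num_real//.
have := normr_ge0 (X i t); nra.
Qed.

Lemma indep2_pair i j : i != j -> indep2 P (X i) (X j).
Proof.
move=> ij; have := @indep i [:: j]; rewrite /= inE ij => /(_ isT).
by congr indep2; apply/funext => t; rewrite big_seq1.
Qed.

Lemma mean_sqr_indep_sum (J : seq nat) : uniq J ->
  L1 (fun t => (\sum_(j <- J) X j t) ^+ 2) /\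
  mean (fun t => (\sum_(j <- J) X j t) ^+ 2) = \sum_(j <- J) mean (fun t => X j t ^+ 2).
Proof.
move=> uJ; apply: mean_sqr_sum => // i j ij.
have [iXX ->] := mean_indep2M (iX i) (iX j) (indep2_pair ij).
by rewrite X0 mul0r.
Qed.

Let S (J : seq nat) t := \sum_(j <- J) X j t.

Let mS J : measurable_fun setT (S J).
Proof. exact: measurable_sum. Qed.

Lemma S_rem i J t : i \in J -> S J t = X i t + S (rem i J) t.
Proof. by move=> iJ; rewrite /S (big_rem i). Qed.

Lemma uniq_cons_rem (i : nat) J : uniq J -> uniq (i :: rem i J).
Proof. by move=> uJ; rewrite /= rem_uniq// mem_rem_uniqF. Qed.

Definition trunc_sqr (e x : R) : R := x ^+ 2 * (`|x| <= e)%R%:R.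

Lemma mean_norm_S J : uniq J -> \sum_(j <- J) mean (fun t => X j t ^+ 2) <= 1 ->
  L1 (fun t => `|S J t|) /\ mean (fun t => `|S J t|) <= 1.
Proof.
move=> uJ J1; have [iS ES] := mean_sqr_indep_sum uJ.
split; last by apply: (mean_norm_le_sqr (mS J)) => //; rewrite expr1n ES.
apply: L1_norm; have iH : L1 (fun t => 1 + S J t ^+ 2) by apply: L1D => //; exact: L1_cst.
apply: L1_dom iH _ => // t.
rewrite -[X in _ <= 1 + X]real_normK ?num_real//.
have := normr_ge0 (S J t); nra.
Qed.

Lemma trunc_sqr_ge0 e x : 0 <= trunc_sqr e x.
Proof. by rewrite mulr_ge0 ?sqr_ge0. Qed.

Lemma trunc_sqr_le e x : 0 <= e -> trunc_sqr e x <= e ^+ 2.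
Proof.
move=> e0; rewrite /trunc_sqr; case: (leP `|x| e) => xe; rewrite /= ?mulr0n ?mulr1n ?mulr0 ?mulr1 ?sqr_ge0//.
by rewrite -real_normK ?num_real// ler_pXn2r.
Qed.

Lemma measurable_trunc_sqr e : measurable_fun setT (trunc_sqr e).
Proof.
apply: measurable_funM; first exact: exprn_measurable.
by apply: measurable_natb; apply: measurable_fun_ler => //; exact: measurableT_comp.
Qed.

(* truncated variance *)
(** The truncated squares are pairwise independent and at most e ^ 2, so that
the variance of their sum is at most e ^ 2 times the sum of the E [X_j ^ 2]. *)
Lemma mean_trunc_sqr_sum J (e : R) : uniq J -> 0 < e ->
  \sum_(j <- J) mean (fun t => X j t ^+ 2) <= 1 ->
  let N t := \sum_(j <- J) trunc_sqr e (X j t) in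
  L1 N /\ mean (fun t => `|N t - \sum_(j <- J) mean (fun t => trunc_sqr e (X j t))|) <= e.
Proof.
move=> uJ e0 J1 N.
have mtr := measurable_trunc_sqr e.
have tr0 := trunc_sqr_ge0 e.
have tre x := trunc_sqr_le x (ltW e0).
have itr i : L1 (fun t => trunc_sqr e (X i t)).
  apply: (@L1_bounded _ (e ^+ 2)); first exact: measurableT_comp.
  by move=> t; rewrite ger0_norm.
split; first exact: L1_sum.
pose Y i t := trunc_sqr e (X i t) - mean (fun t => trunc_sqr e (X i t)).
have iY i : L1 (Y i) by apply: L1B => //; exact: L1_cst.
have Ye i t : `|Y i t| <= e ^+ 2.
  have h0 := tr0 (X i t); have h1 := tre (X i t).
  have h2 : 0 <= mean (fun t => trunc_sqr e (X i t)) by exact: mean_ge0.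
  have h3 : mean (fun t => trunc_sqr e (X i t)) <= e ^+ 2.
    by rewrite -[leRHS]mean_cst; apply: mean_le => //; exact: L1_cst.
  by rewrite /Y ler_norml; lra.
have iY2 i : L1 (fun t => Y i t ^+ 2).
  apply: (@L1_bounded _ (e ^+ 2 * e ^+ 2)).
    by apply: measurable_funX; exact: L1_measurable.
  by move=> t; rewrite normrX expr2 ler_pM.
have YY i j : i != j -> L1 (fun t => Y i t * Y j t) /\ mean (fun t => Y i t * Y j t) = 0.
  move=> ij.
  have mc (k : nat) : measurable_fun setT (fun x => trunc_sqr e x - mean (fun t => trunc_sqr e (X k t))).
    exact: measurable_funB.
  have := mean_indep2M (iY i) (iY j) (indep2_comp (mc i) (mc j) (indep2_pair ij)).
  rewrite meanB ?mean_cst ?subrr ?mul0r//; exact: L1_cst.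
have [iN EN] := mean_sqr_sum uJ iY2 YY.
have -> : (fun t => `|N t - \sum_(j <- J) mean (fun t => trunc_sqr e (X j t))|) = fun t => `|\sum_(j <- J) Y j t|.
  by apply/funext => t; rewrite /Y /N sumrB.
apply: mean_norm_le_sqr => //.
  by apply: L1_measurable; exact: L1_sum.
rewrite EN.
apply: (@le_trans _ _ (\sum_(j <- J) (e ^+ 2 * mean (fun t => X j t ^+ 2)))); last first.
  by rewrite -mulr_sumr ler_piMr ?sqr_ge0.
apply: ler_sum => j _.
set m := mean (fun t => trunc_sqr e (X j t)).
have m0 : 0 <= m by exact: mean_ge0.
have iZ : L1 (fun t => e ^+ 2 * X j t ^+ 2 - 2 * m * trunc_sqr e (X j t) + m ^+ 2).
  by apply: L1D; [apply: L1B; exact: L1Z|exact: L1_cst].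
apply: (@le_trans _ _ (mean (fun t => e ^+ 2 * X j t ^+ 2 - 2 * m * trunc_sqr e (X j t) + m ^+ 2))).
  apply: mean_le => // t; rewrite /Y -/m.
  rewrite (_ : (_ - m) ^+ 2 = trunc_sqr e (X j t) ^+ 2 - 2 * m * trunc_sqr e (X j t) + m ^+ 2); last by ring.
  rewrite !lerD2r expr2 ler_pM//.
  by rewrite /trunc_sqr ler_piMr ?sqr_ge0 ?lern1 ?leq_b1.
rewrite meanD ?mean_cst; [|by apply: L1B; exact: L1Z|exact: L1_cst].
rewrite meanB ?meanZ//; [|exact: L1Z|exact: L1Z].
by rewrite -/m; nra.
Qed.

Definition clip (c u : R) : R := Num.max (- c) (Num.min c u).

Lemma clip_homo c : {homo clip c : u v / u <= v}.
Proof.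
by move=> u v uv; rewrite /clip ge_max le_max lexx /= le_max le_min !ge_min lexx uv !orbT.
Qed.

Lemma norm_clip c u : 0 <= c -> `|clip c u| <= c.
Proof.
move=> c0; rewrite ler_norml /clip le_max lexx /= ge_max ge_min lexx /= andbT.
by rewrite (le_trans _ c0)// oppr_le0.
Qed.

Lemma clip_id c u : `|u| <= c -> clip c u = u.
Proof.
by rewrite ler_norml => /andP[h1 h2]; rewrite /clip (min_idPr h2) (max_idPr h1).
Qed.

Lemma measurable_clip c : measurable_fun setT (clip c).
Proof. by apply: measurable_maxr => //; exact: measurable_minr. Qed.

(** Let f be the identity centred at the middle of [a, b] and clipped a distance
e beyond its ends. On the one hand |f| <= c with c = (b - a) / 2 + e bounds
E [S f(S)] by c. On the other hand, by independence, E [S f(S)] is the sum of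
E [X_j (f(S) - f(S - X_j))]; each of these increments is nonnegative because f is
monotone, and equals X_j ^ 2 when S is in [a, b] and |X_j| <= e. Hence E [S f(S)]
dominates the truncated variance on the event a <= S <= b, and the truncated
variance is within e of its mean, which is at least 1/2. *)
Lemma concentration J (e a b : R) : uniq J -> 0 < e -> a <= b ->
  \sum_(j <- J) mean (fun t => X j t ^+ 2) <= 1 ->
  2^-1 <= \sum_(j <- J) mean (fun t => trunc_sqr e (X j t)) ->
  fine (P [set t | a <= S J t <= b]) <= (b - a) + 4 * e.
Proof.
move=> uJ e0 ab J1 N2.
have [iS ES] := mean_norm_S uJ J1.
have [iN EN] := mean_trunc_sqr_sum uJ e0 J1.
set N := fun t => _ in iN EN; set m := \sum_(j <- J) _ in N2 EN.
pose c := (b - a) / 2 + e.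
have c0 : 0 <= c by rewrite /c; lra.
pose f (u : R) := clip c (u - (a + b) / 2).
have mf : measurable_fun setT f.
  apply: measurableT_comp; last exact: measurable_funB.
  exact: measurable_clip.
have fc u : `|f u| <= c by exact: norm_clip.
pose A : set T := [set t | a <= S J t <= b].
have mb : measurable_fun setT (fun t => a <= S J t <= b).
  by apply: measurable_and; apply: measurable_fun_ler.
have mA : measurable A by exact: measurable_setb.
have key (s x : R) : (a <= s <= b)%R%:R * trunc_sqr e x <= x * (f s - f (s - x)).
  have xf0 : 0 <= x * (f s - f (s - x)).
    have [x0|x0] := leP 0 x.
      by rewrite mulr_ge0// subr_ge0 clip_homo//; lra.
    by rewrite mulr_le0// ?(ltW x0)// subr_le0 clip_homo//; lra.
  rewrite /trunc_sqr.
  have [/andP[as_ sb]|_] := boolP (a <= s <= b); last by rewrite mul0r.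
  have [|_] := leP `|x| e; last by rewrite !mulr0.
  rewrite ler_norml => /andP[xe1 xe2]; rewrite /= mul1r mulr1 /f !clip_id.
  - by rewrite le_eqVlt; apply/orP; left; apply/eqP; ring.
  - by rewrite ler_norml /c; lra.
  - by rewrite ler_norml /c; lra.
have itf J' : L1 (fun t => f (S J' t)).
  apply: (@L1_bounded _ c) => //; exact: measurableT_comp.
have iXf j J' : L1 (fun t => X j t * f (S J' t)).
  apply: (L1_dom (g := fun t => c * `|X j t|)).
  - by apply: measurable_funM => //; exact: measurableT_comp.
  - exact/L1Z/L1_norm.
  - by move=> t; rewrite normrM mulrC ler_wpM2r.
have Xf0 j : j \in J -> mean (fun t => X j t * f (S (rem j J) t)) = 0.
  move=> jJ; have ind := indep (uniq_cons_rem j uJ).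
  have indf := indep2_comp (measurable_id (D := setT)) mf ind.
  have [_ ->] := mean_indep2M (iX j) (itf _) indf.
  by rewrite X0 mul0r.
have up : mean (fun t => S J t * f (S J t)) <= c.
  apply: (@le_trans _ _ (mean (fun t => c * `|S J t|))).
    apply: mean_le; last 2 first.
    - exact: L1Z.
    - by move=> t; apply: le_trans (ler_norm _) _; rewrite normrM mulrC ler_wpM2r.
    have -> : (fun t => S J t * f (S J t)) = fun t => \sum_(j <- J) X j t * f (S J t).
      by apply/funext => t; rewrite mulr_suml.
    exact: L1_sum.
  by rewrite meanZ// ler_piMr.
have iAtr j : L1 (fun t => (a <= S J t <= b)%R%:R * trunc_sqr e (X j t)).
  apply: (@L1_bounded _ (e ^+ 2)).
    apply: measurable_funM; first exact: measurable_natb.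
    by apply: measurableT_comp => //; exact: measurable_trunc_sqr.
  move=> t; rewrite ger0_norm; last by apply: mulr_ge0 => //; exact: trunc_sqr_ge0.
  apply: le_trans (trunc_sqr_le (X j t) (ltW e0)).
  by rewrite ler_piMl ?lern1 ?leq_b1//; exact: trunc_sqr_ge0.
have low : mean (fun t => (a <= S J t <= b)%R%:R * N t) <= mean (fun t => S J t * f (S J t)).
  have -> : (fun t => (a <= S J t <= b)%R%:R * N t) = fun t => \sum_(j <- J) (a <= S J t <= b)%R%:R * trunc_sqr e (X j t).
    by apply/funext => t; rewrite /N mulr_sumr.
  have -> : (fun t => S J t * f (S J t)) = fun t => \sum_(j <- J) X j t * f (S J t).
    by apply/funext => t; rewrite mulr_suml.
  rewrite !mean_sum// big_seq [leRHS]big_seq; apply: ler_sum => j jJ.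
  rewrite -[leRHS]subr0 -(Xf0 j jJ) -meanB//.
  apply: mean_le => //; first exact: L1B.
  move=> t; rewrite -mulrBr.
  have -> : S (rem j J) t = S J t - X j t by rewrite (S_rem t jJ) addrAC subrr add0r.
  exact: key.
have mid : m * fine (P A) - e <= mean (fun t => (a <= S J t <= b)%R%:R * N t).
  have iA : L1 (fun t => (a <= S J t <= b)%R%:R) by exact: L1_natb.
  have iNm : L1 (fun t => `|N t - m|) by apply: L1_norm; apply: L1B => //; exact: L1_cst.
  have iAN : L1 (fun t => (a <= S J t <= b)%R%:R * N t).
    have -> : (fun t => (a <= S J t <= b)%R%:R * N t) = fun t => \sum_(j <- J) (a <= S J t <= b)%R%:R * trunc_sqr e (X j t).
      by apply/funext => t; rewrite /N mulr_sumr.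
    exact: L1_sum.
  rewrite -mean_natb// -meanZ//; apply: (@le_trans _ _ (mean (fun t => m * (a <= S J t <= b)%R%:R) - mean (fun t => `|N t - m|))).
    by rewrite lerB.
  rewrite -meanB//; last exact: L1Z.
  apply: mean_le => //; first by apply: L1B => //; exact: L1Z.
  move=> t; rewrite lerBlDr -lerBlDl.
  case: (_ <= _ <= _) => /=; rewrite ?mulr1 ?mul1r ?mul0r ?mulr0 ?subr0.
    by rewrite distrC; exact: ler_norm.
  exact: normr_ge0.
have PA0 : 0 <= fine (P A) by rewrite fine_ge0.
have : m * fine (P A) <= c + e by lra.
have : 2^-1 * fine (P A) <= m * fine (P A) by rewrite ler_wpM2r.
rewrite /c -/A; lra.
Qed.

(** The last inequality is Chebyshev's association inequality: f ^ 2 and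
min1 f are both increasing functions of |f|. *)
Lemma mean_sqrM_min1 f : measurable_fun setT f -> L1 (fun t => f t ^+ 2) ->
  [/\ L1 (fun t => min1 (f t)), L1 (fun t => f t ^+ 2 * min1 (f t)) &
  mean (fun t => f t ^+ 2) * mean (fun t => min1 (f t)) <= mean (fun t => f t ^+ 2 * min1 (f t))].
Proof.
move=> mf if2.
have mm : measurable_fun setT (@min1 R).
  by apply: measurable_minr => //; exact: measurableT_comp.
have i1 : L1 (fun t => min1 (f t)).
  apply: (@L1_bounded _ 1); first exact: measurableT_comp.
  by move=> t; rewrite ger0_norm ?min1_ge0 ?min1_le1.
have i2 : L1 (fun t => f t ^+ 2 * min1 (f t)).
  apply: (L1_dom (g := fun t => f t ^+ 2)) => //.
    by apply: measurable_funM; [exact: measurable_funX|exact: measurableT_comp].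
  move=> t; rewrite ger0_norm; last by apply: mulr_ge0; [exact: sqr_ge0|exact: min1_ge0].
  by rewrite ler_piMr ?sqr_ge0 ?min1_le1.
split=> //.
set v := mean (fun t => f t ^+ 2).
have v0 : 0 <= v by apply: mean_ge0 => t; exact: sqr_ge0.
pose r := Num.sqrt v.
have r2 : r ^+ 2 = v by rewrite sqr_sqrtr.
have sq (a b : R) : `|a| <= `|b| -> a ^+ 2 <= b ^+ 2.
  move=> ab; rewrite -[a ^+ 2]real_normK ?num_real// -[b ^+ 2]real_normK ?num_real//.
  by rewrite ler_pXn2r ?nnegrE.
have H t : 0 <= (f t ^+ 2 * min1 (f t) - v * min1 (f t)) - (min1 r * f t ^+ 2 - min1 r * v).
  rewrite (_ : _ - _ = (f t ^+ 2 - r ^+ 2) * (min1 (f t) - min1 r)); last by rewrite r2; ring.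
  have [h|/ltW h] := leP `|r| `|f t|.
    by rewrite mulr_ge0// subr_ge0 ?min1_homo// sq.
  by rewrite mulr_le0// subr_le0 ?min1_homo// sq.
have := mean_ge0 H.
rewrite meanB; [|by apply: L1B => //; exact: L1Z|by apply: L1B; [exact: L1Z|exact: L1_cst]].
rewrite !meanB; [|exact: L1Z|exact: L1_cst|by []|exact: L1Z].
rewrite mean_cst (meanZ v i1) (meanZ (min1 r) if2) -/v subrr subr0 subr_ge0//.
Qed.

(** * The Berry-Esseen bound *)

Section berry_esseen.
Variables (J : seq nat) (G : R).
Hypothesis uJ : uniq J.
Hypothesis J1 : \sum_(j <- J) mean (fun t => X j t ^+ 2) = 1.
Hypothesis G0 : 0 < G.
Hypothesis JG : \sum_(j <- J) mean (fun t => X j t ^+ 2 * min1 (X j t)) <= G.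
Hypothesis G8 : G <= 8^-1.
Local Notation K := (@stein_cst R).
Let W i := S (rem i J).

Let var_rem i : i \in J -> \sum_(j <- rem i J) mean (fun t => X j t ^+ 2) <= 1.
Proof.
move=> iJ; have := J1; rewrite (big_rem i)//= => <-.
by rewrite lerDr; apply: mean_ge0 => t; exact: sqr_ge0.
Qed.

(** Truncating at 4 G loses at most G / (4 G) = 1/4 of the unit variance, and
dropping the i-th term loses at most (4 G) ^ 2 <= 1/4 more. *)
Let trunc_rem i : i \in J ->
  2^-1 <= \sum_(j <- rem i J) mean (fun t => trunc_sqr (4 * G) (X j t)).
Proof.
move=> iJ; have e0 : 0 < 4 * G by rewrite mulr_gt0.
have e2 : 4 * G <= 2^-1 by have := G8; lra.
have pw x : x ^+ 2 - (4 * G)^-1 * (x ^+ 2 * min1 x) <= trunc_sqr (4 * G) x.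
  rewrite /trunc_sqr; have [xe|xe] := leP `|x| (4 * G); rewrite /= ?mulr1n ?mulr0n ?mulr1 ?mulr0.
    by rewrite gerBl; apply: mulr_ge0; [by rewrite invr_ge0 ltW|apply: mulr_ge0; [exact: sqr_ge0|exact: min1_ge0]].
  rewrite mulrCA -[X in X - _]mulr1 -mulrBr mulr_ge0_le0 ?sqr_ge0// subr_le0.
  rewrite ler_pdivlMl// mulr1 /min1 le_min (ltW xe) andbT; lra.
have itr j : L1 (fun t => trunc_sqr (4 * G) (X j t)).
  apply: (@L1_bounded _ ((4 * G) ^+ 2)).
    by apply: measurableT_comp => //; exact: measurable_trunc_sqr.
  by move=> t; rewrite ger0_norm ?trunc_sqr_ge0 ?trunc_sqr_le// ltW.
have iXm j : L1 (fun t => X j t ^+ 2 * min1 (X j t)).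
  by have [] := mean_sqrM_min1 (mX j) (iX2 j).
have hJ : 1 - (4 * G)^-1 * G <= \sum_(j <- J) mean (fun t => trunc_sqr (4 * G) (X j t)).
  apply: (@le_trans _ _ (\sum_(j <- J) (mean (fun t => X j t ^+ 2) -
      (4 * G)^-1 * mean (fun t => X j t ^+ 2 * min1 (X j t))))).
    by rewrite sumrB J1 -mulr_sumr lerD2l lerN2 ler_wpM2l// invr_ge0 ltW.
  apply: ler_sum => j _; rewrite -meanZ// -meanB//; last exact: L1Z.
  by apply: mean_le => //; apply: L1B => //; exact: L1Z.
have : (4 * G)^-1 * G = 4^-1 by field; rewrite gt_eqF.
move=> G4; move: hJ; rewrite G4 (big_rem i)//=.
have : mean (fun t => trunc_sqr (4 * G) (X i t)) <= (4 * G) ^+ 2.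
  by rewrite -[leRHS]mean_cst; apply: mean_le => //; [exact: L1_cst|move=> t; rewrite trunc_sqr_le// ltW].
nra.
Qed.

Let near_prob i (z r : R) : i \in J -> 0 <= r ->
  fine (P [set t | `|W i t - z| <= r]) <= 2 * r + 16 * G.
Proof.
move=> iJ r0; have e0 : 0 < 4 * G by rewrite mulr_gt0.
have ab : z - r <= z + r by lra.
have := concentration (rem_uniq i uJ) e0 ab (var_rem iJ) (trunc_rem iJ).
under eq_set do rewrite -ler_distl.
by move=> h; apply: le_trans h _; lra.
Qed.

Let mW i : measurable_fun setT (W i). Proof. exact: mS. Qed.

Let L1_W i : i \in J -> L1 (fun t => `|W i t|) /\ mean (fun t => `|W i t|) <= 1.
Proof. by move=> iJ; apply: mean_norm_S (var_rem iJ); exact: rem_uniq. Qed.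

Let m_near z (r : R) i : measurable_fun setT (fun t => `|W i t - z| <= r).
Proof.
apply: measurable_fun_ler => //; apply: measurableT_comp => //.
exact: measurable_funB.
Qed.

Let L1_stein_mod i z x : i \in J -> L1 (fun t => stein_mod z x (W i t)).
Proof.
move=> iJ; have [iW _] := L1_W iJ.
apply: L1D; last exact/L1_natb/m_near.
rewrite (_ : (fun t => _) = fun t => K * min1 x * (`|W i t| + 1)).
  by apply/L1Z/L1D => //; exact: L1_cst.
by apply/funext => t; ring.
Qed.

(** The average of [stein_mod z x] over W_i: E |W_i| <= 1 for the first term, the
concentration inequality for the indicator. *)
Let bnd x := (2 * K + 2) * min1 x + 16 * G.

Let mean_stein_mod i z x : i \in J -> mean (fun t => stein_mod z x (W i t)) <= bnd x.
Proof.
move=> iJ; have [iW EW] := L1_W iJ; have K2 := @stein_cst_ge2 R.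
have m0 := min1_ge0 x.
rewrite (_ : (fun t => _) = fun t => K * min1 x * (`|W i t| + 1) + (`|W i t - z| <= `|x|)%R%:R); last first.
  by apply/funext => t; rewrite /stein_mod; ring.
have iW1 : L1 (fun t => `|W i t| + 1) by apply: L1D => //; exact: L1_cst.
rewrite meanD; [|exact: L1Z|exact/L1_natb/m_near].
rewrite meanZ// meanD//; last exact: L1_cst.
rewrite mean_cst mean_natb//.
have P1 : fine (P [set t | `|W i t - z| <= `|x|]) <= 2 * min1 x + 16 * G.
  rewrite /min1; case: (leP 1 `|x|) => x1; last exact: near_prob.
  apply: (@le_trans _ _ 1); last by have := G0; lra.
  rewrite -lee_fin fineK ?fin_num_measure ?probability_le1//; exact/measurable_setb/m_near.
have : K * min1 x * (mean (fun t => `|W i t|) + 1) <= K * min1 x * 2.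
  by rewrite ler_wpM2l ?mulr_ge0//; lra.
by rewrite /bnd; lra.
Qed.

Let m_stein_mod z : measurable_fun setT (fun u : R * R => stein_mod z u.1 u.2).
Proof.
have m1 : measurable_fun setT (fun u : R * R => u.1) by exact: measurable_fst.
have m2 : measurable_fun setT (fun u : R * R => u.2) by exact: measurable_snd.
apply: measurable_funD; last first.
  apply: measurable_natb; apply: measurable_fun_ler.
    by apply: measurableT_comp => //; exact: measurable_funB.
  exact: measurableT_comp.
apply: measurable_funM.
  apply: measurable_funM => //; apply: measurable_funD => //.
  exact: measurableT_comp.
by apply: measurable_minr => //; exact: measurableT_comp.
Qed.

Let indW i : i \in J -> indep2 P (X i) (W i).
Proof. by move=> iJ; exact/indep/uniq_cons_rem. Qed.

Let weighted i z (h : R -> R) : i \in J -> measurable_fun setT h -> (forall x, 0 <= h x) ->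
  L1 (fun t => h (X i t) * bnd (X i t)) ->
  L1 (fun t => h (X i t) * stein_mod z (X i t) (W i t)) /\
  mean (fun t => h (X i t) * stein_mod z (X i t) (W i t)) <= mean (fun t => h (X i t) * bnd (X i t)).
Proof.
move=> iJ mh h0 ib.
apply: (@mean_indep2_le (X i) (W i) (fun x w => h x * stein_mod z x w) (fun x => h x * bnd x)) => //.
- exact: indW.
- apply: measurable_funM => //; apply: measurableT_comp => //; exact: measurable_fst.
- by move=> x y; rewrite mulr_ge0 ?stein_mod_ge0.
- by move=> x; apply/L1Z/L1_stein_mod.
- by move=> x; rewrite meanZ ?ler_wpM2l ?mean_stein_mod//; exact: L1_stein_mod.
Qed.

(** Both dstein z S and the difference quotient of stein z between W_i and S are
compared with dstein z W_i, which is independent of X_i and thus contributes the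
same amount, E [X_i ^ 2] * E [dstein z W_i], to both sides. *)
Let term i z : i \in J ->
  `|mean (fun t => X i t ^+ 2) * mean (fun t => dstein z (S J t)) -
    mean (fun t => X i t * (stein z (S J t) - stein z (W i t)))| <=
  (4 * K + 4) * mean (fun t => X i t ^+ 2 * min1 (X i t)) + 32 * G * mean (fun t => X i t ^+ 2).
Proof.
move=> iJ; set v := mean (fun t => X i t ^+ 2).
have v0 : 0 <= v by apply: mean_ge0 => t; exact: sqr_ge0.
have [im im2 Em] := mean_sqrM_min1 (mX i) (iX2 i).
have mf : measurable_fun setT (stein z).
  by apply: continuous_measurable_fun; exact: continuous_stein.
have mg : measurable_fun setT (dstein z).
  apply: measurable_funB => //; apply: measurable_funD; first exact: measurable_funM.
  by apply: measurable_natb; exact: measurable_fun_ler.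
have ig (Y : T -> R) : measurable_fun setT Y -> L1 (fun t => dstein z (Y t)).
  move=> mY; apply: (@L1_bounded _ 2); first exact: measurableT_comp.
  by move=> t; exact: dstein_bound.
have iXf (Y : T -> R) : measurable_fun setT Y -> L1 (fun t => X i t * stein z (Y t)).
  move=> mY; apply: (L1_dom (g := fun t => mills 0 * `|X i t|)).
  - by apply: measurable_funM => //; exact: measurableT_comp.
  - exact/L1Z/L1_norm.
  - move=> t; rewrite normrM mulrC ler_wpM2r// ger0_norm ?stein_ge0//.
    exact: stein_bound.
have [iXg EXg] : L1 (fun t => X i t ^+ 2 * dstein z (W i t)) /\
    mean (fun t => X i t ^+ 2 * dstein z (W i t)) = v * mean (fun t => dstein z (W i t)).
  apply: mean_indep2M => //; first exact: ig.
  exact: (indep2_comp (exprn_measurable 2) mg (indW iJ)).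
have SE t : S J t = W i t + X i t by rewrite (S_rem t iJ) addrC.
have ib1 : L1 (fun t => 1 * bnd (X i t)).
  under eq_fun do rewrite mul1r.
  by apply: L1D; [exact: L1Z|exact: L1_cst].
have ib2 : L1 (fun t => X i t ^+ 2 * bnd (X i t)).
  rewrite (_ : (fun _ => _) = fun t => (2 * K + 2) * (X i t ^+ 2 * min1 (X i t)) + 16 * G * X i t ^+ 2).
    by apply: L1D; exact: L1Z.
  by apply/funext => t; rewrite /bnd; ring.
have [iw1 Ew1] := @weighted i z (fun=> 1) iJ (measurable_cst _) (fun=> ler01) ib1.
have [iw2 Ew2] := @weighted i z (fun x => x ^+ 2) iJ (exprn_measurable 2) (@sqr_ge0 R) ib2.
have ig2 : L1 (fun t => dstein z (S J t) - dstein z (W i t)) by apply: L1B; exact: ig.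
have iT : L1 (fun t => X i t * (stein z (S J t) - stein z (W i t)) - X i t ^+ 2 * dstein z (W i t)).
  apply: L1B => //; under eq_fun do rewrite mulrBr.
  by apply: L1B; exact: iXf.
have -> : v * mean (fun t => dstein z (S J t)) -
    mean (fun t => X i t * (stein z (S J t) - stein z (W i t))) =
    v * mean (fun t => dstein z (S J t) - dstein z (W i t)) -
    mean (fun t => X i t * (stein z (S J t) - stein z (W i t)) - X i t ^+ 2 * dstein z (W i t)).
  have iU : L1 (fun t => X i t * (stein z (S J t) - stein z (W i t))).
    by under eq_fun do rewrite mulrBr; apply: L1B; exact: iXf.
  rewrite (meanB (ig _ (mS J)) (ig _ (mW i))) (meanB iU iXg) EXg; ring.
have h1 : `|mean (fun t => dstein z (S J t) - dstein z (W i t))| <= mean (fun t => 1 * bnd (X i t)).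
  apply: le_trans (norm_mean ig2) (le_trans _ Ew1).
  apply: mean_le => //; first exact: L1_norm.
  by move=> t; rewrite mul1r; apply: dstein_sub; rewrite SE addrAC subrr add0r.
have h2 : `|mean (fun t => X i t * (stein z (S J t) - stein z (W i t)) - X i t ^+ 2 * dstein z (W i t))|
    <= mean (fun t => X i t ^+ 2 * bnd (X i t)).
  apply: le_trans (norm_mean iT) (le_trans _ Ew2).
  apply: mean_le => //; first exact: L1_norm.
  by move=> t; rewrite SE; exact: stein_taylor.
have e1 : mean (fun t => 1 * bnd (X i t)) = (2 * K + 2) * mean (fun t => min1 (X i t)) + 16 * G.
  under eq_fun do rewrite mul1r.
  by rewrite /bnd (meanD (L1Z (2 * K + 2) im) (L1_cst (16 * G))) (meanZ _ im) mean_cst.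
have e2 : mean (fun t => X i t ^+ 2 * bnd (X i t)) =
    (2 * K + 2) * mean (fun t => X i t ^+ 2 * min1 (X i t)) + 16 * G * v.
  rewrite (_ : (fun _ => _) = fun t => (2 * K + 2) * (X i t ^+ 2 * min1 (X i t)) + 16 * G * X i t ^+ 2).
    by rewrite (meanD (L1Z (2 * K + 2) im2) (L1Z (16 * G) (iX2 i))) (meanZ _ im2) (meanZ _ (iX2 i)).
  by apply/funext => t; rewrite /bnd; ring.
apply: le_trans (ler_normB _ _) _; rewrite normrM (ger0_norm v0).
have K2 := @stein_cst_ge2 R.
have h3 := ler_wpM2l v0 h1.
have h4 : (2 * K + 2) * (v * mean (fun t => min1 (X i t))) <= (2 * K + 2) * mean (fun t => X i t ^+ 2 * min1 (X i t)).
  by rewrite ler_wpM2l//; lra.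
rewrite e1 in h3; rewrite e2 in h2; nra.
Qed.

(** Stein's equation at S, in mean; as the variances add up to 1, the error is the
sum of the errors in [term]. *)
Lemma berry_esseen_small z :
  `|fine (P [set t | S J t <= z]) - Phi z| <= (4 * K + 36) * G.
Proof.
have mf : measurable_fun setT (stein z).
  by apply: continuous_measurable_fun; exact: continuous_stein.
have mb : measurable_fun setT (fun t => S J t <= z) by exact: measurable_fun_ler.
have iSf : L1 (fun t => S J t * stein z (S J t)).
  apply: (@L1_bounded _ 1); last by move=> t; exact: normM_stein.
  by apply: measurable_funM => //; exact: measurableT_comp.
have iXf i J' : L1 (fun t => X i t * stein z (S J' t)).
  apply: (L1_dom (g := fun t => mills 0 * `|X i t|)).
  - by apply: measurable_funM => //; exact: measurableT_comp.
  - exact/L1Z/L1_norm.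
  - move=> t; rewrite normrM mulrC ler_wpM2r// ger0_norm ?stein_ge0//.
    exact: stein_bound.
have Eg : mean (fun t => dstein z (S J t)) =
    mean (fun t => S J t * stein z (S J t)) + (fine (P [set t | S J t <= z]) - Phi z).
  rewrite /dstein; under [in LHS]eq_fun do rewrite -addrA.
  have ib := L1_natb mb.
  have ic : L1 (fun t => (S J t <= z)%R%:R - Phi z) by apply: L1B => //; exact: L1_cst.
  rewrite meanD// meanB//; last exact: L1_cst.
  by rewrite mean_cst mean_natb.
have ESf : mean (fun t => S J t * stein z (S J t)) =
    \sum_(i <- J) mean (fun t => X i t * (stein z (S J t) - stein z (W i t))).
  have -> : (fun t => S J t * stein z (S J t)) = fun t => \sum_(j <- J) X j t * stein z (S J t).
    by apply/funext => t; rewrite mulr_suml.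
  rewrite mean_sum//; apply: eq_big_seq => i iJ.
  under [in RHS]eq_fun do rewrite mulrBr.
  rewrite (meanB (iXf i J) (iXf i (rem i J))).
  have ind : indep2 P (X i) (fun t => stein z (W i t)).
    exact: (indep2_comp (measurable_id (D := setT)) mf (indW iJ)).
  have iW : L1 (fun t => stein z (W i t)).
    apply: (@L1_bounded _ (mills 0)); first exact: measurableT_comp.
    by move=> t; rewrite ger0_norm ?stein_ge0 ?stein_bound.
  by have [_ ->] := mean_indep2M (iX i) iW ind; rewrite X0 mul0r subr0.
have -> : fine (P [set t | S J t <= z]) - Phi z =
    \sum_(i <- J) (mean (fun t => X i t ^+ 2) * mean (fun t => dstein z (S J t)) -
      mean (fun t => X i t * (stein z (S J t) - stein z (W i t)))).
  by rewrite sumrB -mulr_suml J1 mul1r -ESf Eg; ring.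
apply: le_trans (ler_norm_sum _ _ _) _.
apply: (@le_trans _ _ (\sum_(i <- J) ((4 * K + 4) * mean (fun t => X i t ^+ 2 * min1 (X i t)) +
    32 * G * mean (fun t => X i t ^+ 2)))).
  by rewrite big_seq [leRHS]big_seq; apply: ler_sum => i iJ; exact: term.
rewrite big_split /= -!mulr_sumr J1 mulr1.
have : (4 * K + 4) * \sum_(j <- J) mean (fun t => X j t ^+ 2 * min1 (X j t)) <= (4 * K + 4) * G.
  rewrite ler_wpM2l//.
  by have := @stein_cst_ge2 R; lra.
by lra.
Qed.

End berry_esseen.

(** For G > 1/8 the right-hand side exceeds 1. *)
Lemma berry_esseen J (G z : R) : uniq J ->
  \sum_(j <- J) mean (fun t => X j t ^+ 2) = 1 -> 0 < G ->
  \sum_(j <- J) mean (fun t => X j t ^+ 2 * min1 (X j t)) <= G ->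
  `|fine (P [set t | \sum_(j <- J) X j t <= z]) - Phi z| <= (4 * stein_cst + 36) * G.
Proof.
move=> uJ J1 G0 JG; have [G8|G8] := leP G 8^-1; first exact: berry_esseen_small.
have K2 := @stein_cst_ge2 R.
apply: (@le_trans _ _ 1); last first.
  have : 36 * 8^-1 <= (4 * stein_cst + 36) * G by rewrite ler_pM//; lra.
  lra.
have := Phi_ge0 z; have := Phi_le1 z.
have : fine (P [set t | \sum_(j <- J) X j t <= z]) <= 1.
  rewrite -lee_fin fineK ?probability_le1 ?fin_num_measure//.
    by apply: measurable_setb; apply: measurable_fun_ler => //; exact: mS.
  by apply: measurable_setb; apply: measurable_fun_ler => //; exact: mS.
have : 0 <= fine (P [set t | \sum_(j <- J) X j t <= z]) by rewrite fine_ge0.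
by rewrite ler_norml; lra.
Qed.

End concentration.

End expectation.

(** * Linearization of noisy orbits *)

Section dynamics.
Context {R : realType}.
Implicit Types (f : R -> R) (x : R).

Section flow.
Variables (f : R -> R) (D0 : set R).
Hypothesis fD0 : forall y, D0 y -> D0 (f y).
Hypothesis df : forall y, D0 y -> derivable f y 1.

Lemma iter_invariant i x : D0 x -> D0 (iter i f x).
Proof. by move=> Dx; elim: i => //= i; exact: fD0. Qed.

Lemma derivable_iter k y : D0 y -> derivable (iter k f) y 1.
Proof.
move=> Dy; elim: k => [|k IH] /=; first exact: derivable_id.
have h1 := derivableP IH.
have h2 := derivableP (df (iter_invariant k Dy)).
by have [] := is_derive1_comp h2 h1.
Qed.

Lemma dflow_diag x n : dflow f x n n = 1.
Proof. by rewrite /dflow subnn derive1E; exact: derive_id. Qed.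

Lemma dflowS x i j : D0 x -> (j <= i)%N ->
  dflow f x i.+1 j = (derive1 f) (iter i f x) * dflow f x i j.
Proof.
move=> Dx ji; rewrite /dflow subSn//.
have Dj := iter_invariant j Dx.
have := derive1_comp (@derivable_iter (i - j) _ Dj) (df (iter_invariant (i - j)%N Dj)).
by rewrite -iterD subnK.
Qed.

Variables (x : R) (Dx : D0 x) (n : nat).
Local Notation Lh := (Lambda_hat f x n).

Lemma Lambda_hat_ge i : (i <= n)%N -> \sum_(0 <= j < i.+1) `|dflow f x i j| <= Lh.
Proof.
move=> iN; rewrite /Lambda_hat.
apply: (@le_bigmax_seq _ R _ _ _ i xpredT (fun i => \sum_(0 <= j < i.+1) `|dflow f x i j|)) => //.
by rewrite mem_index_iota leq0n ltnS.
Qed.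

Lemma Lambda_hat_ge1 : 1 <= Lh.
Proof.
apply: le_trans (Lambda_hat_ge (leq0n n)).
by rewrite big_nat1 dflow_diag normr1.
Qed.

Lemma norm_dflow_sum_le (s : nat -> R) (K : R) i : (i <= n)%N -> 0 <= K ->
  (forall j, (1 <= j <= i)%N -> `|s j| <= K) ->
  `|\sum_(1 <= j < i.+1) dflow f x i j * s j| <= Lh * K.
Proof.
move=> iN K0 sK; apply: le_trans (ler_norm_sum _ _ _) _.
apply: (@le_trans _ _ (\sum_(1 <= j < i.+1) `|dflow f x i j| * K)).
  rewrite big_nat [leRHS]big_nat; apply: ler_sum => j; rewrite ltnS => /andP[j1 ji].
  by rewrite normrM ler_wpM2l// sK// j1.
rewrite -mulr_suml ler_wpM2r//; apply: le_trans (Lambda_hat_ge iN).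
by rewrite [leRHS]big_ltn// lerDr.
Qed.

Variables (D : set R) (F : R).
Hypothesis F0 : 0 <= F.
Hypothesis Taylor : forall y u, D0 y -> D u ->
  `|f u - f y - (derive1 f) y * (u - y)| <= F * (u - y) ^+ 2.

(** The deviation e_i of X from the orbit of f is the linear response to the
kicks s_j plus the Taylor remainders r_j (variation of constants), and |r_j| is
at most F * e_(j-1) ^ 2. By strong induction |e_i| <= 2 Lh K: under the smallness
assumption, the remainders then contribute no more than the kicks. Inserting this
bound into the remainders once more gives the quadratic estimate. *)
Lemma orbit_linearization (X s : nat -> R) (K : R) :
  X 0%N = x -> (forall i, X i.+1 = f (X i) + s i.+1) ->
  0 <= K -> (forall j, (1 <= j <= n)%N -> `|s j| <= K) ->
  (forall i, (i <= n)%N -> D (X i)) ->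
  4 * F * Lh ^+ 2 * K <= 1 ->
  `|X n - iter n f x - \sum_(1 <= j < n.+1) dflow f x n j * s j| <= 4 * F * Lh ^+ 3 * K ^+ 2.
Proof.
move=> X0 XS K0 sK DX small.
pose e i := X i - iter i f x.
pose r i := if i is k.+1 then f (X k) - f (iter k f x) - (derive1 f) (iter k f x) * e k else 0.
have eE i : e i = \sum_(1 <= j < i.+1) dflow f x i j * (s j + r j).
  elim: i => [|i IH]; first by rewrite big_geq// /e X0 subrr.
  rewrite big_nat_recr//= dflow_diag mul1r.
  rewrite (eq_big_nat _ _ (F2 := fun j => (derive1 f) (iter i f x) * (dflow f x i j * (s j + r j)))); last first.
    by move=> j /andP[_ ji]; rewrite dflowS// mulrA.
  by rewrite -mulr_sumr -IH /e XS /=; ring.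
have Lh1 := Lambda_hat_ge1.
have Lh0 : 0 <= Lh by apply: le_trans Lh1.
have eB i : (i <= n)%N -> `|e i| <= 2 * (Lh * K).
  elim/ltn_ind: i => i IH iN.
  rewrite eE; under eq_bigr do rewrite mulrDr.
  rewrite big_split /=; apply: le_trans (ler_normD _ _) _.
  have h1 : `|\sum_(1 <= j < i.+1) dflow f x i j * s j| <= Lh * K.
    apply: norm_dflow_sum_le => // j /andP[j1 ji].
    by rewrite sK// j1 (leq_trans ji).
  have h2 : `|\sum_(1 <= j < i.+1) dflow f x i j * r j| <= Lh * (F * (2 * (Lh * K)) ^+ 2).
    apply: norm_dflow_sum_le => //; first by rewrite mulr_ge0 ?sqr_ge0.
    case=> // k /andP[_ ki] /=.
    have kn : (k <= n)%N by rewrite (leq_trans (ltnW ki)).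
    apply: le_trans (Taylor _ _) _; [exact: iter_invariant|exact: DX|].
    rewrite ler_wpM2l// -real_normK ?num_real// ler_pXn2r// ?nnegrE ?mulr_ge0//.
    exact: IH.
  have h3 : Lh * (F * (2 * (Lh * K)) ^+ 2) <= Lh * K.
    rewrite (_ : Lh * (F * _) = (4 * F * Lh ^+ 2 * K) * (Lh * K)); last by ring.
    by rewrite ler_piMl// mulr_ge0.
  lra.
rewrite -/(e n) eE; under eq_bigr do rewrite mulrDr.
rewrite big_split /= addrAC subrr add0r.
rewrite (_ : 4 * F * Lh ^+ 3 * K ^+ 2 = Lh * (F * (2 * (Lh * K)) ^+ 2)); last by ring.
apply: norm_dflow_sum_le => //; first by rewrite mulr_ge0 ?sqr_ge0.
case=> // k /andP[_ ki] /=.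
have kn : (k <= n)%N by rewrite ltnW.
apply: le_trans (Taylor _ _) _; [exact: iter_invariant|exact: DX|].
rewrite ler_wpM2l// -real_normK ?num_real// ler_pXn2r// ?nnegrE ?mulr_ge0//.
exact: eB.
Qed.

End flow.

(** The base point y is interior, but u may be an end of the segment, where f is
only continuous. This is why the mean value theorem is applied twice, to f and
to f', rather than a Taylor formula on the closed segment. *)
Lemma taylor_remainder_segment f (l h F y u : R) :
  {within `[l, h], continuous f} ->
  {in `]l, h[, forall t, derivable f t 1 /\ derivable (derive1 f) t 1} ->
  {in `]l, h[, forall t, `|(derive1 (derive1 f)) t| <= F} ->
  0 <= F -> l < y < h -> l <= u <= h ->
  `|f u - f y - (derive1 f) y * (u - y)| <= F * (u - y) ^+ 2.
Proof.
move=> cf df f2F F0 /andP[ly yh] /andP[lu uh].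
have df1 t : l < t < h -> is_derive t 1 f ((derive1 f) t).
  by move=> lt; rewrite derive1E; apply: derivableP; apply: (df t _).1; rewrite inE/= in_itv.
have df2 t : l < t < h -> is_derive t 1 (derive1 f) ((derive1 (derive1 f)) t).
  move=> lt; rewrite [derive1 (derive1 f) t]derive1E; apply: derivableP.
  by apply: (df t _).2; rewrite inE/= in_itv.
have lip a b : l < a -> a <= b -> b < h -> `|(derive1 f) b - (derive1 f) a| <= F * (b - a).
  move=> la ab bh; have [c cab ->] : exists2 c, a <= c <= b & (derive1 f) b - (derive1 f) a = (derive1 (derive1 f)) c * (b - a).
    have df2' t : a <= t <= b -> is_derive t 1 (derive1 f) (derive1 (derive1 f) t).
      by move=> /andP[at_ tb]; apply: df2; rewrite (lt_le_trans la)// (le_lt_trans tb).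
    exact: (MVT_le ab df2').
  rewrite normrM (ger0_norm (_ : 0 <= b - a)) ?subr_ge0// ler_wpM2r ?subr_ge0//.
  apply: f2F; rewrite inE/= in_itv/=; move: cab => /andP[ac cb].
  by rewrite (lt_le_trans la)// (le_lt_trans cb).
have mvt a b : l <= a -> a < b -> b <= h ->
    exists2 c, a < c < b & f b - f a = (derive1 f) c * (b - a).
  move=> la ab bh; have [||c] := @MVT R f (derive1 f) a b ab.
  - move=> t; rewrite in_itv/= => /andP[at_ tb]; apply: df1.
    by rewrite (le_lt_trans la)// (lt_le_trans tb).
  - by apply: continuous_subspaceW cf; apply: subset_itv; rewrite bnd_simp.
  - by rewrite in_itv/=; exists c.
have [yu|uy|->] := ltgtP y u; last by rewrite !subrr mulr0 subr0 normr0 expr0n mulr0.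
- have [c /andP[yc cu] ->] := mvt y u (ltW ly) yu uh.
  rewrite -mulrBl normrM (gtr0_norm (_ : 0 < u - y)) ?subr_gt0// expr2 mulrA ler_wpM2r ?subr_ge0 ?(ltW yu)//.
  by apply: le_trans (lip y c ly (ltW yc) (lt_le_trans cu uh)) _; rewrite ler_wpM2l//; lra.
- have [c /andP[uc cy] E] := mvt u y lu uy (ltW yh).
  rewrite (_ : _ - _ = (derive1 f y - derive1 f c) * (y - u)); last by rewrite mulrBl -E; ring.
  rewrite normrM (gtr0_norm (_ : 0 < y - u)) ?subr_gt0//.
  rewrite (_ : (u - y) ^+ 2 = (y - u) * (y - u)); last by ring.
  rewrite mulrA ler_wpM2r ?subr_ge0 ?(ltW uy)//.
  by apply: le_trans (lip c y (le_lt_trans lu uc) (ltW cy) yh) _; rewrite ler_wpM2l//; lra.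
Qed.

End dynamics.

(** * The three phase spaces *)

Section clip.
Context {R : realType}.
Lemma continuous_clip (c : R) : continuous (clip c).
Proof.
have -> : clip c = fun u => Num.max (- c) (Num.min c u) by [].
move=> u; apply: (@continuous_max _ _ (cst (- c)) (fun u => Num.min c u)); first exact: cvg_cst.
by apply: continuous_min; [exact: cvg_cst|exact: cvg_id].
Qed.
End clip.

Section phase_space.
Context {R : realType}.
Implicit Types (M : phase_space R) (f : R -> R).

Definition orbit_domain M : set R :=
  match M with
  | Line | Circle => setT
  | Defs.Interval a => `[-1 - a, 1 + a]
  end.

Definition has_margin M := if M is Defs.Interval _ then true else false.

Lemma admissible_carrier M f y : admissible_map M f -> carrier M y -> orbit_domain M y.
Proof.
case: M => //= a [a0 _ _]; rewrite !in_itv/= => /andP[h1 h2].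
by apply/andP; split; lra.
Qed.

Lemma admissible_maps M f y : admissible_map M f -> orbit_domain M y -> carrier M (f y).
Proof. by case: M => //= a [_ _ fI] ay; apply: fI; exists y. Qed.

Lemma admissible_derivable M f y : admissible_map M f -> carrier M y -> derivable f y 1.
Proof.
case: M => /= [[df _ _] _|[[df _ _] _] _|a [a0 [_ df _ _] _]]; [exact: df|exact: df|].
rewrite in_itv/= => /andP[h1 h2]; apply: (df y _).1; rewrite inE/= in_itv/=.
by apply/andP; split; lra.
Qed.

Lemma admissible_C0_norm_ge0 M f : (0 <= C0_norm M f^`(2))%E.
Proof.
have [y My] : exists y, carrier M y.
  by exists 0; case: M => //= a; rewrite in_itv/=; apply/andP; split; lra.
by apply: (@le_trans _ _ (`|f^`(2)%classic y|)%:E); [rewrite lee_fin|apply: ereal_sup_ubound; exists y].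
Qed.

Lemma le_C0_norm M f (F y : R) : C0_norm M f^`(2) = F%:E -> carrier M y ->
  `|derive1 (derive1 f) y| <= F.
Proof.
by move=> fF My; rewrite -lee_fin -fF; apply: ereal_sup_ubound; exists y.
Qed.

Lemma C2_continuous f : C2 f -> continuous f.
Proof.
by move=> [df _ _] y; apply: differentiable_continuous; exact/derivable1_diffP.
Qed.

Lemma C2_taylor f (F : R) : C2 f -> 0 <= F ->
  (forall t, `|derive1 (derive1 f) t| <= F) ->
  forall y u, `|f u - f y - derive1 f y * (u - y)| <= F * (u - y) ^+ 2.
Proof.
move=> fC F0 f2 y u; have [df d2f _] := fC.
pose h := `|y| + `|u| + 1.
have := ler_norm y; have := ler_norm u.
have := lerNnormlW (lexx `|y|); have := lerNnormlW (lexx `|u|) => nu ny pu py.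
have := normr_ge0 y; have := normr_ge0 u => u0 y0.
apply: (@taylor_remainder_segment _ f (- h) h) => //.
- by apply: continuous_subspaceT; exact: C2_continuous.
- by apply/andP; split; rewrite /h; lra.
- by apply/andP; split; rewrite /h; lra.
Qed.

Lemma within_continuous_bounded (u v : R) (g : R -> R) : u <= v ->
  {within `[u, v], continuous g} -> exists2 K, 0 <= K & {in `[u, v], forall t, `|g t| <= K}.
Proof.
move=> uv cg.
have [c1 _ h1] := EVT_max uv cg.
have [c2 _ h2] := EVT_min uv cg.
exists (`|g c1| + `|g c2|); first by rewrite addr_ge0.
move=> t; rewrite inE/= => tI; have := h1 t tI; have := h2 t tI.
have := ler_norm (g c1); have := lerNnormlW (lexx `|g c2|).
have := normr_ge0 (g c1); have := normr_ge0 (g c2).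
rewrite ler_norml; lra.
Qed.

(** On the interval, u may lie in the margin, where |f''| is bounded by some
constant but not by F; the factor k is the quotient of the two bounds. *)
Lemma admissible_taylor M f (F : R) : admissible_map M f ->
  C0_norm M f^`(2) = F%:E -> (has_margin M -> 0 < F) ->
  exists2 k : R, 0 <= k & forall y u, carrier M y -> orbit_domain M u ->
    `|f u - f y - derive1 f y * (u - y)| <= k * F * (u - y) ^+ 2.
Proof.
move=> fM fF; have F0 : 0 <= F by rewrite -lee_fin -fF; exact: admissible_C0_norm_ge0.
case: M fM fF => /= [fC fF _|[fC _] fF _|a [a0 [cf df _ [g cg gE]] fI] fF /(_ isT) F1].
- exists 1 => // y u _ _; rewrite mul1r; apply: C2_taylor => // t.
  exact: (le_C0_norm fF).
- exists 1 => // y u _ _; rewrite mul1r; apply: C2_taylor => // t.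
  exact: (le_C0_norm fF).
- have aa : -1 - a <= 1 + a by lra.
  have [K K0 gK] := within_continuous_bounded aa cg.
  exists (K / F); first by rewrite divr_ge0 // ltW.
  move=> y u; rewrite !in_itv/= => /andP[y1 y2] uI; rewrite divfK ?gt_eqF//.
  apply: (@taylor_remainder_segment _ f (-1 - a) (1 + a)) => //.
    move=> t tI; have := gE _ tI; rewrite /derive1n/= => ->.
    apply: gK; move: tI; rewrite !inE/=; exact: subset_itv_oo_cc.
  by apply/andP; split; lra.
Qed.

(** As f'' vanishes on [-1, 1], f has a constant slope alpha there. If |alpha|
were at least 1, then f would map one of the points -1, 1 to 1, the largest value
that f takes on the whole segment [-1 - a, 1 + a]; this point being interior, the
slope would be 0. *)
Lemma affine_interval a f x : admissible_map (Defs.Interval a) f ->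
  C0_norm (Defs.Interval a) f^`(2) = 0%E -> carrier (Defs.Interval a) x ->
  exists2 alpha, `|alpha| < 1 & forall n j, (j <= n)%N -> dflow f x n j = alpha ^+ (n - j).
Proof.
move=> fM f20 xI; have [a0 [cf df _ _] fI] := fM.
have in1 t : -1 - a < t < 1 + a -> t \in (`]-1 - a, 1 + a[%classic : set R).
  by move=> tI; rewrite inE/= in_itv.
have df1 t : -1 - a < t < 1 + a -> is_derive t 1 f (derive1 f t).
  by move=> tI; rewrite derive1E; apply: derivableP; exact: (df t (in1 _ tI)).1.
have df2 t : -1 - a < t < 1 + a -> is_derive t 1 (derive1 f) (derive1 (derive1 f) t).
  by move=> tI; rewrite [derive1 (derive1 f) t]derive1E; apply: derivableP; exact: (df t (in1 _ tI)).2.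
have f2 t : -1 <= t <= 1 -> derive1 (derive1 f) t = 0.
  move=> tI; apply/normr0_eq0/le_anti; rewrite normr_ge0 andbT.
  by apply: (le_C0_norm f20) => /=; rewrite in_itv.
pose alpha := derive1 f (-1).
have f1 t : -1 <= t <= 1 -> derive1 f t = alpha.
  move=> /andP[t1 t2].
  have H (u : R) : -1 <= u <= t -> is_derive u 1 (derive1 f) (derive1 (derive1 f) u).
    by move=> /andP[u1 u2]; apply: df2; apply/andP; split; lra.
  have [c /andP[c1 c2]] := MVT_le t1 H; rewrite f2; last by apply/andP; split; lra.
  by rewrite mul0r => /eqP; rewrite subr_eq0 => /eqP.
have f11 : f 1 - f (-1) = alpha * 2.
  have H (u : R) : -1 <= u <= 1 -> is_derive u 1 f (derive1 f u).
    by move=> /andP[u1 u2]; apply: df1; apply/andP; split; lra.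
  have m11 : -1 <= 1 :> R by lra.
  by have [c cI ->] := MVT_le m11 H; rewrite f1//; lra.
have fle t : -1 - a <= t <= 1 + a -> -1 <= f t <= 1.
  by move=> tI; have := fI (f t); rewrite /= in_itv/=; apply; exists t => //; rewrite in_itv.
have max0 c : -1 <= c <= 1 -> f c = 1 -> alpha = 0.
  move=> cI fc; have cI' : c \in `]-1 - a, 1 + a[%R.
    by rewrite in_itv/=; move: cI => /andP[c1 c2]; apply/andP; split; lra.
  have := @derive1_at_max _ f (-1 - a) (1 + a) c _ _ cI' _.
  case; [lra| | |].
  - by move=> t tI; apply: (df t _).1; rewrite inE.
  - move=> t; rewrite in_itv/= fc => /andP[t1 t2].
    by have /andP[] : -1 <= f t <= 1 by apply: fle; apply/andP; split; lra.
  - by move=> _; rewrite -derive1E f1.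
exists alpha.
  have h1 : -1 <= f 1 <= 1 by apply: fle; apply/andP; split; lra.
  have h2 : -1 <= f (-1) <= 1 by apply: fle; apply/andP; split; lra.
  have m1 : -1 <= (1 : R) <= 1 by apply/andP; split; lra.
  have m2 : -1 <= (-1 : R) <= 1 by apply/andP; split; lra.
  have n1 := max0 1 m1; have n2 := max0 (-1) m2.
  move: h1 h2 => /andP[h1 h1'] /andP[h2 h2'].
  rewrite ltr_norml; apply/andP; split; rewrite ltNge; apply/negP => al.
    have /n2 : f (-1) = 1 by lra.
    lra.
  have /n1 : f 1 = 1 by lra.
  lra.
have Dmap y : carrier (Defs.Interval a) y -> carrier (Defs.Interval a) (f y).
  by move=> yI; apply: (admissible_maps fM); exact: (admissible_carrier fM).
have Dder y := @admissible_derivable _ _ y fM.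
move=> n j; elim: n => [|n IH]; first by rewrite leqn0 => /eqP ->; rewrite dflow_diag.
rewrite leq_eqVlt => /predU1P[->|]; first by rewrite dflow_diag subnn.
rewrite ltnS => jn; rewrite (dflowS Dmap Dder)// IH// subSn// exprS f1//.
by have := iter_invariant Dmap n xI; rewrite /= in_itv.
Qed.

Lemma orbit_in_domain (T : Type) (xi : nat -> T -> R) M f (sigma x : R) n w :
  admissible_map M f -> carrier M x -> 0 <= sigma ->
  (~` exit_event M xi sigma n) w ->
  forall i, (i <= n)%N -> orbit_domain M (noisy_orbit xi f sigma x i w).
Proof.
move=> fM xM s0; case: M fM xM => // a fM xI.
rewrite /exit_event /= => /negP; rewrite -leNgt => smax.
elim=> [_|i IH ilt]; first exact: (admissible_carrier fM xI).
have := admissible_maps fM (IH (ltnW ilt)).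
rewrite /= !in_itv/= => /andP[f1 f2].
have : `|sigma * xi i.+1 w| <= a.
  apply: le_trans smax; rewrite normrM ger0_norm// ler_wpM2l//.
  apply: (@le_bigmax_seq _ R _ _ _ i.+1 xpredT (fun j => `|xi j w|)) => //.
  by rewrite mem_index_iota /= ltnS.
by rewrite ler_norml => /andP[s1 s2]; apply/andP; split; lra.
Qed.

(** Outside the segment an admissible f is arbitrary, possibly not measurable; g
serves to prove that events about noisy orbits are measurable. *)
Lemma admissible_continuous_extension M f : admissible_map M f ->
  exists2 g : R -> R, continuous g & forall y, orbit_domain M y -> g y = f y.
Proof.
case: M => /= [fC|[fC _]|a [a0 [cf _ _ _] _]].
- by exists f => //; exact: C2_continuous.
- by exists f => //; exact: C2_continuous.
- have clipI t : -1 - a <= clip (1 + a) t <= 1 + a.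
    have := @norm_clip _ (1 + a) t; rewrite ler_norml opprD => /(_ _)/andP[|h1 h2]; first lra.
    by apply/andP; split; lra.
  exists (fun t => f (clip (1 + a) t)).
    move=> t; have /subspace_continuousP := cf.
    move=> /(_ (clip (1 + a) t)); rewrite /= in_itv/= => /(_ (clipI t)).
    move=> cft; apply: cvg_comp cft.
    move=> U UA.
    have h : nbhs t (clip (1 + a) @^-1` [set z | `[-1 - a, 1 + a]%classic z -> U z]).
      exact: (@continuous_clip _ (1 + a) t _ UA).
    change (nbhs t (clip (1 + a) @^-1` U)).
    by apply: filterS h => z hz; apply: hz; rewrite /= in_itv/=; exact: clipI.
  move=> y; rewrite in_itv/= => /andP[y1 y2].
  by rewrite clip_id// ler_norml; apply/andP; split; lra.
Qed.

End phase_space.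

(** * Lyapunov ratios *)

Lemma sqr_powR_half (R : realType) (y s : R) : 0 <= y -> (y ^+ 2) `^ (s / 2) = y `^ s.
Proof. by move=> y0; rewrite -powR_mulrn// -powRrM; congr powR; field. Qed.

Lemma powR_invl (R : realType) (y s : R) : 0 <= y -> y^-1 `^ s = (y `^ s)^-1.
Proof. by move=> y0; rewrite -[y^-1]powR_inv1// -powRrM mulN1r powRN. Qed.

Section ratio.
Context {R : realType}.
Variables (f : R -> R) (x : R) (n : nat).
Hypothesis n0 : (0 < n)%N.
Local Notation d j := (dflow f x n j).

Definition lyapunov_ratio (s : R) : R := Lambda f s x n / Lambda f 2 x n `^ (s / 2).

Lemma Lambda2E : Lambda f 2 x n = \sum_(1 <= j < n.+1) d j ^+ 2.
Proof.
apply: eq_bigr => j _; rewrite powR_mulrn//.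
by rewrite real_normK ?num_real.
Qed.

Lemma Lambda_ge1 (s : R) : 1 <= Lambda f s x n.
Proof.
rewrite /Lambda big_nat_recr//= dflow_diag normr1 powR1 lerDr.
by apply: sumr_ge0 => j _; exact: powR_ge0.
Qed.

Lemma Lambda2_gt0 : 0 < Lambda f 2 x n.
Proof. exact: lt_le_trans (Lambda_ge1 2). Qed.

Let r := Num.sqrt (Lambda f 2 x n).

Let r1 : 1 <= r.
Proof. by rewrite /r -[leLHS]sqrtr1 ler_wsqrtr// Lambda_ge1. Qed.

Let r0 : 0 < r. Proof. exact: lt_le_trans r1. Qed.

Lemma Lambda2_powR_half (s : R) : Lambda f 2 x n `^ (s / 2) = r `^ s.
Proof.
by rewrite -[in LHS](sqr_sqrtr (ltW Lambda2_gt0)) sqr_powR_half ?(ltW r0).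
Qed.

Let b j := `|d j| / r.

Let b0 j : 0 <= b j. Proof. by rewrite divr_ge0// ltW. Qed.

Lemma lyapunov_ratioE (s : R) : lyapunov_ratio s = \sum_(1 <= j < n.+1) b j `^ s.
Proof.
rewrite /lyapunov_ratio Lambda2_powR_half /Lambda mulr_suml; apply: eq_bigr => j _.
by rewrite /b powRM ?invr_ge0 ?(ltW r0)// powR_invl// ltW.
Qed.

Let b2 : \sum_(1 <= j < n.+1) b j ^+ 2 = 1.
Proof.
rewrite (eq_bigr (fun j => d j ^+ 2 * r ^- 2)); last first.
  by move=> j _; rewrite /b expr_div_n real_normK ?num_real.
rewrite -mulr_suml -Lambda2E /r sqr_sqrtr ?(ltW Lambda2_gt0)// divff//.
by rewrite gt_eqF// Lambda2_gt0.
Qed.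

Lemma lyapunov_ratio_gt0 (s : R) : 0 < lyapunov_ratio s.
Proof.
rewrite /lyapunov_ratio divr_gt0 ?powR_gt0 ?Lambda2_gt0//.
exact: lt_le_trans (Lambda_ge1 s).
Qed.

(** In terms of the normalized weights b_j, whose squares add up to 1, b_j ^ s is
at most e ^ (s - 2) b_j ^ 2 if b_j <= e, and at most e ^ (s - p) b_j ^ p
otherwise. *)
Lemma lyapunov_ratio_interpolation (s p e : R) : 2 <= s -> s <= p -> 0 < e ->
  lyapunov_ratio s <= e `^ (s - 2) + e `^ (s - p) * lyapunov_ratio p.
Proof.
move=> s2 sp e0; have -> : e `^ (s - 2) = \sum_(1 <= j < n.+1) e `^ (s - 2) * b j ^+ 2.
  by rewrite -mulr_sumr b2 mulr1.
rewrite !lyapunov_ratioE mulr_sumr -big_split /=.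
apply: ler_sum => j _.
have p0 : p != 0 by rewrite gt_eqF//; lra.
have s0 : s != 0 by rewrite gt_eqF//; lra.
have [->|bj] := eqVneq (b j) 0.
  by rewrite !powR0// expr0n !mulr0 addr0.
have bj0 : 0 < b j by rewrite lt_neqAle eq_sym bj b0.
have [be|eb] := leP (b j) e.
  have h : b j `^ s <= e `^ (s - 2) * b j ^+ 2.
    have -> : b j `^ s = b j `^ (s - 2) * b j ^+ 2.
      by rewrite -powR_mulrn// -powRD ?bj ?implybT// subrK.
    by rewrite ler_wpM2r ?sqr_ge0// ge0_ler_powR ?subr_ge0 ?nnegrE ?(ltW e0).
  by apply: le_trans h _; rewrite lerDl mulr_ge0 ?powR_ge0.
have h : b j `^ s <= e `^ (s - p) * b j `^ p.
  have -> : b j `^ s = b j `^ (s - p) * b j `^ p by rewrite -powRD ?bj ?implybT// subrK.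
  rewrite ler_wpM2r ?powR_ge0//.
  rewrite -opprB !powRN lef_pV2 ?posrE ?powR_gt0//.
  by rewrite ge0_ler_powR// ?subr_ge0// ?nnegrE ltW.
by apply: le_trans h _; rewrite lerDr mulr_ge0 ?powR_ge0// sqr_ge0.
Qed.

End ratio.

Lemma lyapunov_ratio_cvg0 (R : realType) (f : R -> R) (x s p : R) (n : nat -> nat) :
  (forall k, (0 < n k)%N) -> 2 < s -> s <= p ->
  lyapunov_ratio f x (n k) p @[k --> \oo] --> (0 : R) ->
  lyapunov_ratio f x (n k) s @[k --> \oo] --> (0 : R).
Proof.
move=> n0 s2 sp rp; apply/cvgrPdist_le => h h0.
pose e := (h / 2) `^ (s - 2)^-1.
have h20 : 0 < h / 2 by rewrite divr_gt0.
have e0 : 0 < e by rewrite powR_gt0.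
have eE : e `^ (s - 2) = h / 2.
  by rewrite /e -powRrM mulVf ?powRr1 ?(ltW h20)// gt_eqF// subr_gt0.
have q0 : 0 < e `^ (s - p) by rewrite powR_gt0.
move/cvgrPdist_le : rp => /(_ (h / 2 / e `^ (s - p))) H.
near=> k.
have : `|0 - lyapunov_ratio f x (n k) p| <= h / 2 / e `^ (s - p).
  by near: k; apply: H; rewrite divr_gt0.
rewrite !sub0r !normrN !gtr0_norm ?lyapunov_ratio_gt0// ler_pdivlMr// => hp.
apply: le_trans (lyapunov_ratio_interpolation _ _ (n0 k) (ltW s2) sp e0) _.
by rewrite eE; lra.
Unshelve. all: by end_near. Qed.

(** * Moments of the noise *)

Section Lnorm_real.
Context d (T : measurableType d) (R : realType) (P : probability T R).
Variable Y : T -> R.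
Hypothesis mY : measurable_fun setT Y.

Let mYp (r : R) : measurable_fun setT (fun t => `|Y t| `^ r).
Proof.
apply: (measurableT_comp (f := fun u : R => u `^ r)) => //.
exact: measurableT_comp.
Qed.

Let intE (r : R) : (\int[P]_t (`|(EFin \o Y) t| `^ r) = \int[P]_t (`|Y t| `^ r)%:E)%E.
Proof. by apply: eq_integral. Qed.

Lemma L1_Lnorm_le (r C : R) : 0 < r -> 0 <= C -> ('N[P]_(r%:E)[EFin \o Y] <= C%:E)%E ->
  L1 P (fun t => `|Y t| `^ r) /\ mean P (fun t => `|Y t| `^ r) <= C `^ r.
Proof.
move=> r0 C0 NC.
have I : (\int[P]_t (`|Y t| `^ r)%:E <= (C `^ r)%:E)%E.
  have N0 : (0 <= 'N[P]_(r%:E)[EFin \o Y])%E by exact: Lnorm_ge0.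
  have Nf : ('N[P]_(r%:E)[EFin \o Y])%E \is a fin_num.
    by rewrite ge0_fin_numE// (le_lt_trans NC)// ltry.
  rewrite -intE -poweR_Lnorm ?gt_eqF// -(fineK Nf) poweR_EFin lee_fin.
  rewrite ge0_ler_powR ?nnegrE ?(ltW r0) ?fine_ge0//.
  by rewrite -lee_fin fineK.
have i : L1 P (fun t => `|Y t| `^ r).
  apply/integrableP; split; first exact/measurable_EFinP.
  rewrite (eq_integral (fun t => (`|Y t| `^ r)%:E)).
    by apply: le_lt_trans I _; rewrite ltry.
  by move=> t _ /=; rewrite ger0_norm ?powR_ge0.
split=> //; rewrite -lee_fin /mean /Rintegral fineK//.
exact: integrable_fin_num.
Qed.

Lemma Lnorm_mean (r : R) : L1 P (fun t => `|Y t| `^ r) ->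
  ('N[P]_(r%:E)[EFin \o Y] = (mean P (fun t => `|Y t| `^ r) `^ r^-1)%R%:E)%E.
Proof.
move=> i; rewrite unlock /Lnorm intE -poweR_EFin; congr (_ `^ _)%E.
by rewrite /mean /Rintegral fineK//; exact: integrable_fin_num.
Qed.

Lemma L1_powR_le (s p : R) : 0 <= s -> s <= p -> L1 P (fun t => `|Y t| `^ p) ->
  L1 P (fun t => `|Y t| `^ s) /\
  mean P (fun t => `|Y t| `^ s) <= 1 + mean P (fun t => `|Y t| `^ p).
Proof.
move=> s0 sp ip.
have H t : `|Y t| `^ s <= 1 + `|Y t| `^ p.
  have [y1|y1] := leP `|Y t| 1.
    have : `|Y t| `^ s <= 1 `^ s by rewrite ge0_ler_powR// nnegrE.
    by rewrite powR1 => h; apply: le_trans h _; rewrite lerDl powR_ge0.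
  apply: (@le_trans _ _ (`|Y t| `^ p)); first by rewrite ler_powR// ltW.
  by rewrite lerDr.
have i1 : L1 P (fun t => 1 + `|Y t| `^ p) by apply: L1D => //; exact: L1_cst.
have is_ : L1 P (fun t => `|Y t| `^ s).
  by apply: L1_dom i1 _ => // t; rewrite ger0_norm ?powR_ge0.
split=> //; rewrite -[X in X + _](@mean_cst _ _ _ P) -meanD//; last exact: L1_cst.
exact: mean_le.
Qed.

Lemma powR2E (y : R) : `|y| `^ 2 = y ^+ 2.
Proof. by rewrite powR_mulrn// real_normK ?num_real. Qed.

(** Lyapunov's inequality E [Y ^ 2] <= l ^ 2 for l the L^s norm of Y, obtained
from Young's inequality. Keeping l free covers the case in which that norm
is 0. *)
Lemma mean_sqr_le_powR (s l : R) : 2 < s -> 0 < l -> L1 P (fun t => `|Y t| `^ s) ->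
  L1 P (fun t => Y t ^+ 2) /\
  mean P (fun t => Y t ^+ 2) <= l ^+ 2 * (2 / s * (mean P (fun t => `|Y t| `^ s) / l `^ s) + (1 - 2 / s)).
Proof.
move=> s2 l0 is_; have s0 : 0 < s by lra.
have H t : Y t ^+ 2 <= l ^+ 2 * (2 / s) / l `^ s * `|Y t| `^ s + l ^+ 2 * (1 - 2 / s).
  have q0 : 0 < 1 - 2 / s.
    by rewrite subr_gt0 ltr_pdivrMr// mul1r.
  have := @conjugate_powR R ((`|Y t| / l) ^+ 2) 1 (s / 2) (1 - 2 / s)^-1.
  move=> /(_ (sqr_ge0 _) ler01 (divr_gt0 s0 _) _ _).
  rewrite ltr0n invr_gt0 => /(_ isT q0).
  rewrite invrK.
  have -> : (s / 2)^-1 + (1 - 2 / s) = 1 by field; rewrite gt_eqF.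
  move=> /(_ erefl); rewrite mulr1 powR1 mul1r.
  rewrite sqr_powR_half ?divr_ge0 ?(ltW l0)// powRM ?invr_ge0 ?(ltW l0)//.
  rewrite powR_invl ?(ltW l0)//.
  rewrite expr_div_n real_normK ?num_real// ler_pdivrMr ?exprn_gt0// => h.
  apply: le_trans h _; rewrite le_eqVlt; apply/orP; left; apply/eqP.
  have ls : l `^ s != 0 by rewrite gt_eqF// powR_gt0.
  by field; rewrite ls gt_eqF.
have iH : L1 P (fun t => l ^+ 2 * (2 / s) / l `^ s * `|Y t| `^ s + l ^+ 2 * (1 - 2 / s)).
  by apply: L1D; [exact: L1Z|exact: L1_cst].
have i2 : L1 P (fun t => Y t ^+ 2).
  apply: L1_dom iH _; first exact: measurable_funX.
  by move=> t; rewrite ger0_norm ?sqr_ge0.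
split=> //; apply: le_trans (mean_le i2 iH H) _.
rewrite (meanD (L1Z (l ^+ 2 * (2 / s) / l `^ s) is_) (L1_cst P _)) (meanZ _ is_) mean_cst.
by rewrite le_eqVlt; apply/orP; left; apply/eqP; ring.
Qed.

End Lnorm_real.

Definition moment_bounds d (T : measurableType d) (R : realType)
    (P : probability T R) (xi : nat -> {RV P >-> R}) (p c C : R) :=
  forall n, (0 < n)%N ->
  [/\ mean P (xi n) = 0, L1 P (fun t => xi n t ^+ 2),
   c ^+ 2 <= mean P (fun t => xi n t ^+ 2) <= C ^+ 2,
   L1 P (fun t => `|xi n t| `^ p) & mean P (fun t => `|xi n t| `^ p) <= C `^ p].

Section noise.
Context d (T : measurableType d) (R : realType) (P : probability T R).
Variables (xi : nat -> {RV P >-> R}) (p : R).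
Hypothesis p2 : 2 < p.

Lemma noise_moment_bounds : noise_moments xi p -> exists c C : R,
  [/\ 0 < c, 0 < C & moment_bounds xi p c C].
Proof.
move=> [E0 [c [C [c0 C0 cC]]]]; exists c, C; split=> // n n0.
have [cN [Np NC]] := cC n n0.
have mx : measurable_fun setT (xi n) by [].
have [ip Ep] := L1_Lnorm_le mx (lt_trans (ltr0Sn _ 1) p2) (ltW C0) NC.
have [i2 E2] := L1_Lnorm_le mx (ltr0Sn _ 1) (ltW C0) (le_trans Np NC).
have e2 : (fun t => `|xi n t| `^ 2) = fun t => xi n t ^+ 2.
  by apply/funext => t; rewrite powR2E.
move: cN; rewrite (Lnorm_mean i2) lee_fin => cN.
rewrite e2 in i2 E2 cN; split=> //.
- by have := E0 n n0; rewrite unlock /mean /Rintegral => ->.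
- apply/andP; split; last by rewrite -[C ^+ 2]powR_mulrn ?(ltW C0).
  have v0 : 0 <= mean P (fun t => xi n t ^+ 2) by apply: mean_ge0 => t; exact: sqr_ge0.
  have := @ge0_ler_powR _ 2 (ler0n _ _) c _ _ _ cN; rewrite !nnegrE powR_ge0 (ltW c0) => /(_ isT isT).
  by rewrite -powRrM mulVf// powRr1// powR_mulrn// ltW.
Qed.

Lemma max_noise_ge0 (n : nat) (w : T) : 0 <= max_noise xi n w.
Proof. exact: bigmax_ge_id. Qed.

Lemma max_noise_ge (n j : nat) (w : T) : (1 <= j <= n)%N -> `|xi j w| <= max_noise xi n w.
Proof.
move=> jn; apply: (@le_bigmax_seq _ R _ _ _ j xpredT (fun j => `|xi j w|)) => //.
by rewrite mem_index_iota ltnS.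
Qed.

Lemma measurable_max_noise (n : nat) : measurable_fun setT (max_noise xi n).
Proof.
rewrite /max_noise; elim: (index_iota 1 n.+1) => [|j J IH].
  by under eq_fun do rewrite big_nil; exact: measurable_cst.
under eq_fun do rewrite big_cons.
by apply: measurable_maxr => //; exact: measurableT_comp.
Qed.

Lemma max_noise_powR_le (n : nat) (s : R) (w : T) : 0 < s ->
  `|max_noise xi n w| `^ s <= \sum_(1 <= j < n.+1) `|xi j w| `^ s.
Proof.
move=> s0; rewrite /max_noise; elim: (index_iota 1 n.+1) => [|j J IH].
  by rewrite !big_nil normr0 powR0// gt_eqF.
rewrite !big_cons {1}/Num.max; case: ifP => _.
  by apply: le_trans IH _; rewrite lerDr powR_ge0.
by rewrite normr_id lerDl; apply: sumr_ge0 => i _; exact: powR_ge0.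
Qed.

(** The norm is at least c because the maximum dominates |xi_1|; the last
inequality is Chebyshev's, the second moment being at most N ^ 2. *)
Lemma max_noise_norm (c s : R) (n : nat) : (0 < n)%N -> 0 < c -> 2 < s -> s <= p ->
  (forall j, (0 < j)%N -> L1 P (fun t => `|xi j t| `^ p)) ->
  c ^+ 2 <= mean P (fun t => xi 1%N t ^+ 2) ->
  exists N : R, [/\ ('N[P]_(s%:E)[EFin \o max_noise xi n] = N%:E)%E, c <= N &
    forall e : R, 0 < e ->
      fine (P [set w | N < e * max_noise xi n w]) <= e ^+ 2].
Proof.
move=> n0 c0 s2 sp ip cE.
have s0 : 0 < s by lra.
have mm := measurable_max_noise n.
have mxi j : measurable_fun setT (xi j) by [].
have is_ : L1 P (fun t => `|max_noise xi n t| `^ s).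
  have i1 : L1 P (fun t => \sum_(1 <= j < n.+1) if (0 < j)%N then `|xi j t| `^ s else 0).
    apply: (@L1_sum _ _ _ P _ _ (fun j t => if (0 < j)%N then `|xi j t| `^ s else 0)) => j.
    case: ltnP => j0; last exact: L1_cst.
    by have [] := L1_powR_le (mxi j) (ltW s0) sp (ip j j0).
  apply: L1_dom i1 _.
    apply: (measurableT_comp (f := fun u : R => u `^ s)) => //.
    exact: measurableT_comp.
  move=> t; rewrite ger0_norm ?powR_ge0//; apply: le_trans (max_noise_powR_le _ _ s0) _.
  by rewrite big_nat [leRHS]big_nat; apply: ler_sum => j /andP[-> _].
set V := mean P (fun t => `|max_noise xi n t| `^ s).
have V0 : 0 <= V by apply: mean_ge0 => t; exact: powR_ge0.
have [i2 E2] : L1 P (fun t => max_noise xi n t ^+ 2) /\ forall l : R, 0 < l ->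
    mean P (fun t => max_noise xi n t ^+ 2) <= l ^+ 2 * (2 / s * (V / l `^ s) + (1 - 2 / s)).
  split; first by have [] := mean_sqr_le_powR mm s2 ltr01 is_.
  by move=> l l0; have [] := mean_sqr_le_powR mm s2 l0 is_.
have cm : c ^+ 2 <= mean P (fun t => max_noise xi n t ^+ 2).
  apply: le_trans cE _.
  have i1 : L1 P (fun t => xi 1%N t ^+ 2).
    by have [] := mean_sqr_le_powR (mxi 1%N) p2 ltr01 (ip 1%N isT).
  apply: mean_le => // t; rewrite -[X in X <= _]real_normK ?num_real//.
  by rewrite ler_pXn2r ?nnegrE ?max_noise_ge0 ?max_noise_ge.
have s1 : 0 < 1 - 2 / s by rewrite subr_gt0 ltr_pdivrMr// mul1r.
have V1 : 0 < V.
  rewrite lt_neqAle V0 andbT; apply/eqP => V00.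
  have := E2 (c / 2) (divr_gt0 c0 (ltr0Sn _ 1)); rewrite -V00 mul0r mulr0 add0r => h.
  have h2 : (c / 2) ^+ 2 * (1 - 2 / s) <= (c / 2) ^+ 2.
    by rewrite ler_piMr ?sqr_ge0// gerBl divr_ge0// ltW.
  have : c ^+ 2 <= (c / 2) ^+ 2 by apply: le_trans (le_trans cm h) h2.
  rewrite expr_div_n; have : 0 < c ^+ 2 by rewrite exprn_gt0.
  lra.
pose N := V `^ s^-1.
have N0 : 0 < N by rewrite powR_gt0.
have Ns : N `^ s = V by rewrite /N -powRrM mulVf ?powRr1// gt_eqF.
have mN : mean P (fun t => max_noise xi n t ^+ 2) <= N ^+ 2.
  apply: le_trans (E2 N N0) _; rewrite Ns divff ?gt_eqF//.
  by rewrite le_eqVlt; apply/orP; left; apply/eqP; field; rewrite gt_eqF.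
exists N; split; first exact: Lnorm_mean.
  rewrite -(ler_pXn2r (_ : (0 < 2)%N)) ?nnegrE ?(ltW c0) ?(ltW N0)//.
  exact: le_trans cm mN.
move=> e e0.
have mb : measurable_fun setT (fun w => N < e * max_noise xi n w).
  by apply: measurable_fun_ltr => //; exact: measurable_funM.
rewrite -(mean_natb P mb).
apply: (@le_trans _ _ (mean P (fun t => (e / N) ^+ 2 * max_noise xi n t ^+ 2))).
  apply: mean_le; [exact: L1_natb|exact: L1Z|move=> t].
  case: ltP => [h|_]; last by rewrite mulr_ge0 ?sqr_ge0.
  rewrite -exprMn mulrAC -[leLHS](expr1n _ 2) ler_pXn2r ?nnegrE//.
    by rewrite ler_pdivlMr// mul1r ltW.
  by rewrite divr_ge0 ?mulr_ge0 ?max_noise_ge0 ?(ltW e0) ?(ltW N0).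
rewrite meanZ// (_ : e ^+ 2 = (e / N) ^+ 2 * N ^+ 2).
  by rewrite ler_wpM2l// sqr_ge0.
by rewrite expr_div_n divfK// sqrf_eq0 gt_eqF.
Qed.

Hypothesis indep : independent_noise xi.
Variables (c C : R).
Hypotheses (c0 : 0 < c) (C0 : 0 < C).
Hypothesis moments : moment_bounds xi p c C.

Section weighted_sum.
Variable a : nat -> R.
Let X (j : nat) (t : T) : R := a j * xi j.+1 t.

Let mxi j : measurable_fun setT (xi j). Proof. by []. Qed.

Let mX j : measurable_fun setT (X j).
Proof. exact: measurable_funM. Qed.

Let iX2 j : L1 P (fun t => X j t ^+ 2).
Proof.
have [_ i2 _ _ _] := moments (ltn0Sn j).
rewrite (_ : (fun t => _) = fun t => a j ^+ 2 * xi j.+1 t ^+ 2); first exact: L1Z.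
by apply/funext => t; rewrite /X exprMn.
Qed.

Let ixi j : L1 P (xi j.+1).
Proof.
have [_ i2 _ _ _] := moments (ltn0Sn j).
have iH : L1 P (fun t => 1 + xi j.+1 t ^+ 2) by apply: L1D => //; exact: L1_cst.
apply: L1_dom iH _ => // t.
rewrite -[X in _ <= 1 + X]real_normK ?num_real//.
have := normr_ge0 (xi j.+1 t); nra.
Qed.

Let X0 j : mean P (X j) = 0.
Proof. by have [E0 _ _ _ _] := moments (ltn0Sn j); rewrite /X meanZ// E0 mulr0. Qed.

Let indepX i J : uniq (i :: J) -> indep2 P (X i) (fun t => \sum_(j <- J) X j t).
Proof.
move=> uiJ.
have ui : uniq (i.+1 :: map succn J).
  by rewrite -[_ :: _]/(map succn (i :: J)) map_inj_uniq//; exact: succn_inj.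
have pos : {in i.+1 :: map succn J, forall j, (0 < j)%N}.
  by move=> j; rewrite -[_ :: _]/(map succn (i :: J)) => /mapP[k _ ->].
have mh (k : nat) : measurable_fun setT (fun y : R => a k.-1 * y).
  exact: mulrl_measurable.
have := indep2_noise_sum indep mh ui pos.
move=> /(indep2_comp (mh i.+1) (measurable_id (D := setT))).
congr indep2; apply/funext => t /=.
by rewrite big_map.
Qed.

Lemma mean_sqr_weighted_sum n :
  mean P (fun t => (\sum_(0 <= j < n) a j * xi j.+1 t) ^+ 2) =
  \sum_(0 <= j < n) a j ^+ 2 * mean P (fun t => xi j.+1 t ^+ 2).
Proof.
have [_ ->] := mean_sqr_indep_sum mX iX2 X0 indepX (iota_uniq 0 (n - 0)).
apply: eq_bigr => j _; have [_ i2 _ _ _] := moments (ltn0Sn j).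
rewrite -meanZ//; congr mean; apply/funext => t.
by rewrite /X exprMn.
Qed.

Lemma mean_weighted_sum n : mean P (fun t => \sum_(0 <= j < n) a j * xi j.+1 t) = 0.
Proof.
rewrite mean_sum; last by move=> j; exact: L1Z.
by rewrite big1// => j _; exact: X0.
Qed.

(** Here x ^ 2 min(1, |x|) <= |x| ^ s, because 2 <= s <= 3. *)
Lemma berry_esseen_weighted_sum n (s z : R) : 2 < s -> s <= 3 -> s <= p ->
  \sum_(0 <= j < n) a j ^+ 2 * mean P (fun t => xi j.+1 t ^+ 2) = 1 ->
  `|fine (P [set t | \sum_(0 <= j < n) a j * xi j.+1 t <= z]) - Phi z| <=
  (4 * stein_cst + 36) * ((1 + C `^ p) * \sum_(0 <= j < n) `|a j| `^ s).
Proof.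
move=> s2 s3 sp v1.
apply: (berry_esseen mX iX2 X0 indepX z (iota_uniq 0 (n - 0))).
- rewrite -v1; apply: eq_bigr => j _; have [_ i2 _ _ _] := moments (ltn0Sn j).
  by rewrite -meanZ//; congr mean; apply/funext => t; rewrite /X exprMn.
- rewrite mulr_gt0//; first by rewrite ltr_pwDl// powR_ge0.
  rewrite lt_neqAle sumr_ge0 ?andbT; last by move=> j _; exact: powR_ge0.
  apply/eqP => /esym h; move: v1; rewrite big1_seq; first by move=> /eqP; rewrite eq_sym oner_eq0.
  move=> j /andP[_ jn].
  have /eqP := h; rewrite psumr_eq0; last by move=> i _; exact: powR_ge0.
  move=> /allP /(_ j jn) /=; rewrite powR_eq0 normr_eq0 => /andP[/eqP -> _].
  by rewrite expr0n mul0r.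
- rewrite mulr_sumr; apply: ler_sum => j _.
  have [_ i2 _ ip Ep] := moments (ltn0Sn j).
  have [is_ Es] := L1_powR_le (mxi j.+1) (ltW (lt_trans (ltr0Sn _ 1) s2)) sp ip.
  apply: (@le_trans _ _ (mean P (fun t => `|a j| `^ s * `|xi j.+1 t| `^ s))).
    apply: mean_le; [|exact: L1Z|move=> t].
      by have [] := mean_sqrM_min1 (mX j) (iX2 j).
    rewrite -powRM// -normrM -/(X j t).
    have [->|X_n0] := eqVneq (X j t) 0.
      by rewrite expr0n mul0r powR_ge0.
    have X_gt0 : 0 < `|X j t| by rewrite normr_gt0.
    rewrite -[X in X * _]real_normK ?num_real// /min1; case: (leP 1 `|X j t|) => x1.
      by rewrite mulr1 -powR_mulrn// ler_powR// ltW.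
    by rewrite -exprSr -powR_mulrn// ger_powR// X_gt0 ltW.
  by rewrite meanZ// mulrC ler_wpM2r ?powR_ge0//; apply: le_trans Es _; rewrite lerD2l.
Qed.

End weighted_sum.

End noise.

(** * The linearized noise *)

Section linear_noise.
Context d (T : measurableType d) (R : realType) (P : probability T R).
Variables (xi : nat -> {RV P >-> R}) (p c C : R).
Hypotheses (c0 : 0 < c) (C0 : 0 < C).
Hypothesis indep : independent_noise xi.
Hypothesis moments : moment_bounds xi p c C.
Variables (f : R -> R) (x : R) (n : nat).
Hypothesis n0 : (0 < n)%N.

Let a j := dflow f x n j.+1.

Let linear_noiseE : linear_noise xi f x n = fun t => \sum_(0 <= j < n) a j * xi j.+1 t.
Proof. by apply/funext => t; rewrite /linear_noise big_add1. Qed.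

Let sd := sd_noise P xi f x n.
Let v := \sum_(0 <= j < n) a j ^+ 2 * mean P (fun t => xi j.+1 t ^+ 2).

Let varE : fine 'V_P[linear_noise xi f x n]%E = v.
Proof.
have e0 : fine 'E_P[linear_noise xi f x n]%E = 0.
  rewrite unlock linear_noiseE; exact: (mean_weighted_sum moments).
rewrite /v -(mean_sqr_weighted_sum indep moments).
rewrite /variance unlock e0 unlock /mean /Rintegral; congr fine.
by apply: eq_integral => t _; rewrite /= mulrfctE /= linear_noiseE subr0 expr2.
Qed.

Let Lam2 : Lambda f 2 x n = \sum_(0 <= j < n) a j ^+ 2.
Proof. by rewrite Lambda2E big_add1. Qed.

Let v_ge : c ^+ 2 * Lambda f 2 x n <= v.
Proof.
rewrite Lam2 mulr_sumr; apply: ler_sum => j _.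
have [_ _ /andP[h _] _ _] := moments (ltn0Sn j).
by rewrite mulrC ler_wpM2l ?sqr_ge0.
Qed.

Let v_le : v <= C ^+ 2 * Lambda f 2 x n.
Proof.
rewrite Lam2 mulr_sumr; apply: ler_sum => j _.
have [_ _ /andP[_ h] _ _] := moments (ltn0Sn j).
by rewrite mulrC ler_wpM2r ?sqr_ge0.
Qed.

Lemma sd_noise_ge : c * Num.sqrt (Lambda f 2 x n) <= sd_noise P xi f x n.
Proof.
rewrite /sd_noise varE -[X in X * _]gtr0_norm// -sqrtr_sqr -sqrtrM ?sqr_ge0//.
exact: ler_wsqrtr.
Qed.

Lemma sd_noise_gt0 : 0 < sd_noise P xi f x n.
Proof.
apply: lt_le_trans sd_noise_ge; rewrite mulr_gt0// sqrtr_gt0.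
exact: Lambda2_gt0.
Qed.

(** The Euclidean norm of the weights is at most their sum. *)
Lemma sd_noise_le : sd_noise P xi f x n <= C * Lambda_hat f x n.
Proof.
have h1 := Lambda_hat_ge1 f x n.
have h0 : 0 <= Lambda_hat f x n by lra.
have Lh : Lambda f 2 x n <= Lambda_hat f x n ^+ 2.
  apply: (@le_trans _ _ ((\sum_(1 <= j < n.+1) `|dflow f x n j|) ^+ 2)).
    rewrite Lambda2E; elim: (index_iota 1 n.+1) => [|j J IH].
      by rewrite !big_nil expr0n.
    rewrite !big_cons -[dflow f x n j ^+ 2]real_normK ?num_real// sqrrD.
    rewrite -addrA lerD// (le_trans IH)//.
    by rewrite lerDr mulrn_wge0// mulr_ge0// sumr_ge0.
  rewrite ler_pXn2r ?nnegrE ?sumr_ge0//.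
  apply: le_trans (Lambda_hat_ge f x (leqnn n)).
  by rewrite [leRHS]big_ltn// lerDr.
rewrite /sd_noise varE -[leRHS]ger0_norm ?mulr_ge0 ?(ltW C0)// -sqrtr_sqr.
apply: ler_wsqrtr; apply: le_trans v_le _.
by rewrite exprMn ler_wpM2l// sqr_ge0.
Qed.

Lemma measurable_linear_noise : measurable_fun setT (linear_noise xi f x n).
Proof.
rewrite linear_noiseE; apply: measurable_sum => j.
exact: measurable_funM.
Qed.

Lemma linear_noise_clt (s z : R) : 2 < s -> s <= 3 -> s <= p ->
  `|fine (P [set t | linear_noise xi f x n t / sd_noise P xi f x n <= z]) - Phi z| <=
  (4 * stein_cst + 36) * (1 + C `^ p) / c `^ s * lyapunov_ratio f x n s.
Proof.
move=> s2 s3 sp.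
have sd0 : 0 < sd := sd_noise_gt0.
have v1 : \sum_(0 <= j < n) (a j / sd) ^+ 2 * mean P (fun t => xi j.+1 t ^+ 2) = 1.
  rewrite (eq_bigr (fun j => sd ^- 2 * (a j ^+ 2 * mean P (fun t => xi j.+1 t ^+ 2)))); last first.
    by move=> j _; rewrite expr_div_n mulrAC mulrC.
  rewrite -mulr_sumr -/v -varE -[fine _]sqr_sqrtr.
    by rewrite -/(sd_noise P xi f x n) mulVf// expf_neq0// gt_eqF.
  by rewrite varE; apply: sumr_ge0 => j _; rewrite mulr_ge0 ?sqr_ge0// mean_ge0// => t; rewrite sqr_ge0.
have := berry_esseen_weighted_sum indep moments z s2 s3 sp v1.
have -> : [set t | \sum_(0 <= j < n) a j / sd * xi j.+1 t <= z] =
          [set t | linear_noise xi f x n t / sd <= z].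
  apply/funext => t /=; rewrite linear_noiseE mulr_suml.
  by congr (is_true (_ <= _)); apply: eq_bigr => j _; rewrite mulrAC.
move=> h; apply: le_trans h _.
rewrite -!mulrA; apply: ler_wpM2l.
  by rewrite addr_ge0// mulr_ge0// (le_trans _ stein_cst_ge2).
apply: ler_wpM2l; first by rewrite addr_ge0// powR_ge0.
rewrite /lyapunov_ratio Lambda2_powR_half// mulrCA -invfM -powRM ?sqrtr_ge0 ?(ltW c0)// {1}/Lambda mulr_suml.
rewrite big_add1 /=; apply: ler_sum => j _.
rewrite normrM (powRM _ (normr_ge0 _) (normr_ge0 _)); apply: ler_wpM2l; first exact: powR_ge0.
rewrite normfV gtr0_norm//.
rewrite powR_invl ?(ltW sd0)// lef_pV2 ?posrE ?powR_gt0//.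
  rewrite ge0_ler_powR ?nnegrE ?mulr_ge0 ?sqrtr_ge0 ?(ltW c0) ?(ltW sd0) ?sd_noise_ge//; lra.
by rewrite mulr_gt0// sqrtr_gt0 Lambda2_gt0.
Qed.

End linear_noise.

(** * The effective noise *)

Section events.
Context d (T : measurableType d) (R : realType) (P : probability T R).
Variables (xi : nat -> {RV P >-> R}) (M : phase_space R) (f : R -> R) (x : R).
Hypotheses (fM : admissible_map M f) (xM : carrier M x).

Lemma measurable_noisy_orbit (g : R -> R) (sigma : R) (n : nat) :
  continuous g -> measurable_fun setT (noisy_orbit xi g sigma x n).
Proof.
move=> cg; elim: n => [|n IH] /=; first exact: measurable_cst.
apply: measurable_funD; last exact: measurable_funM.
by apply: measurableT_comp IH; exact: continuous_measurable_fun.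
Qed.

Lemma measurable_exit_event (sigma : R) (n : nat) : measurable (exit_event M xi sigma n).
Proof.
case: M => [||a] /=; [exact: measurable0|exact: measurable0|].
apply: measurable_setb; apply: measurable_fun_ltr => //.
by apply: measurable_funM => //; exact: measurable_max_noise.
Qed.

(** Up to the exit event, f can be replaced by a continuous function without
changing the noisy orbit. *)
Lemma measurable_effective_noise_event (sigma z : R) (n : nat) (B : set T) :
  0 <= sigma -> measurable B ->
  measurable ([set w | effective_noise P xi f sigma x n w * \1_B w <= z] `&`
              ~` exit_event M xi sigma n).
Proof.
move=> s0 mB; have [g cg gf] := admissible_continuous_extension fM.
have same w : (~` exit_event M xi sigma n) w -> forall i, (i <= n)%N ->
    noisy_orbit xi g sigma x i w = noisy_orbit xi f sigma x i w.
  move=> Gw; elim=> [//|i IH] iN; rewrite /= IH ?(ltnW iN)// gf//.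
  exact: (orbit_in_domain fM xM s0 Gw (ltnW iN)).
pose W w := (noisy_orbit xi g sigma x n w - iter n f x) / (sigma * sd_noise P xi f x n).
have -> : [set w | effective_noise P xi f sigma x n w * \1_B w <= z] `&`
    ~` exit_event M xi sigma n =
    [set w | W w * \1_B w <= z] `&` ~` exit_event M xi sigma n.
  by apply/seteqP; split => w [Ew Gw]; split=> //; move: Ew;
    rewrite /= /W /effective_noise same.
apply: measurableI; last by apply: measurableC; exact: measurable_exit_event.
apply: measurable_setb; apply: measurable_fun_ler => //.
apply: measurable_funM; last exact: measurable_indic.
apply: measurable_funM => //; apply: measurable_funB => //.
exact: measurable_noisy_orbit.
Qed.

End events.

Section cond.
Context d (T : measurableType d) (R : realType) (P : probability T R).

Let pr (E : set T) : R := fine (P E).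

Let pr_le E E' : measurable E -> measurable E' -> E `<=` E' -> pr E <= pr E'.
Proof.
move=> mE mE' EE'; rewrite /pr fine_le ?probability_fin ?fin_num_measure//.
by rewrite le_measure ?inE.
Qed.

Let prU E E' : measurable E -> measurable E' -> pr (E `|` E') <= pr E + pr E'.
Proof.
move=> mE mE'; rewrite /pr -fineD ?fin_num_measure// fine_le//.
- by rewrite fin_num_measure//; exact: measurableU.
- by rewrite fin_numD !fin_num_measure.
- exact: measureU2.
Qed.

Let pr_ge0 E : 0 <= pr E. Proof. exact: fine_ge0. Qed.

Let prC E : measurable E -> pr (~` E) = 1 - pr E.
Proof.
by move=> mE; rewrite /pr probability_setC// fineB ?fin_num_measure.
Qed.

Lemma cond_prob_ge0 G E : 0 <= cond_prob P G E.
Proof. by rewrite divr_ge0// fine_ge0. Qed.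

Lemma cond_prob_le1 G E : measurable G -> measurable (E `&` G) -> cond_prob P G E <= 1.
Proof.
move=> mG mE; rewrite /cond_prob.
have [G0|G0] := eqVneq (fine (P G)) 0; first by rewrite G0 invr0 mulr0.
rewrite ler_pdivrMr ?mul1r; last by rewrite lt_neqAle eq_sym G0 fine_ge0.
by apply: pr_le => //; exact: subIsetr.
Qed.

(** Outside B the events about W and about L may differ, and conditioning on G
multiplies probabilities by at most 1 / P(G); both effects cost at most P(~B).
Inside B, shifting z by eta absorbs the difference of W and L, and costs eta
because Phi is 1-Lipschitz. *)
Lemma cond_prob_approx (G B : set T) (W L : T -> R) (z b eta D : R) :
  measurable G -> measurable B -> B `<=` G ->
  measurable_fun setT L ->
  measurable ([set w | W w * \1_B w <= z] `&` G) ->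
  (forall y, `|fine (P [set w | L w <= y]) - Phi y| <= b) ->
  (forall w, B w -> `|W w - L w| <= eta) -> 0 <= eta ->
  fine (P (~` B)) <= D -> D < 1 ->
  `|cond_prob P G [set w | W w * \1_B w <= z] - Phi z| <= b + eta + 2 * D.
Proof.
move=> mG mB BG mL mE bL WL eta0 BD D1.
set E := [set w | W w * \1_B w <= z].
have mLe y : measurable [set w | L w <= y].
  by apply: measurable_setb; apply: measurable_fun_ler.
have lower : pr [set w | L w <= z - eta] <= pr (E `&` G) + D.
  apply: le_trans (_ : pr ((E `&` G) `|` ~` B) <= _); last first.
    by apply: le_trans (prU mE (measurableC mB)) _; rewrite lerD2l.
  apply: pr_le => //; first by apply: measurableU => //; exact: measurableC.
  move=> w /= Lw; have [Bw|nBw] := pselect (B w); [left|by right].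
  split; last exact: BG.
  have := WL w Bw; rewrite /E /= indicE mem_set// mulr1 ler_norml => /andP[_].
  by move: Lw; lra.
have upper : pr (E `&` G) <= pr [set w | L w <= z + eta] + D.
  apply: le_trans (_ : pr ([set w | L w <= z + eta] `|` ~` B) <= _); last first.
    by apply: le_trans (prU _ (measurableC mB)) _ => //; rewrite lerD2l.
  apply: pr_le => //; first by apply: measurableU => //; exact: measurableC.
  move=> w [Ew _]; have [Bw|nBw] := pselect (B w); [left|by right].
  have := WL w Bw; move: Ew; rewrite /E /= indicE mem_set// mulr1 ler_norml => Ww /andP[+ _].
  by move: Ww; lra.
have PhiL := @Phi_lipschitz R (z - eta) z; have PhiU := @Phi_lipschitz R z (z + eta).
have := bL (z - eta); have := bL (z + eta); rewrite !ler_norml -/(pr _) -/(pr _).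
move=> /andP[u1 u2] /andP[l1 l2].
have G1 : 1 - D <= pr G.
  have := pr_le mB mG BG; have := prC mB; rewrite /pr in BD *; move: BD; lra.
have G0 : 0 < pr G by lra.
have Gle1 : pr G <= 1.
  by have := prC mG; have := pr_ge0 (~` G); lra.
have q1 := cond_prob_le1 mG mE.
have q0 := cond_prob_ge0 G E.
have qE : cond_prob P G E * pr G = pr (E `&` G) by rewrite divfK// gt_eqF.
have q2 : pr (E `&` G) <= cond_prob P G E.
  by rewrite -qE ler_piMr.
have q3 : cond_prob P G E <= pr (E `&` G) + D.
  rewrite -qE -lerBlDl -[X in X - _]mulr1 -mulrBr.
  apply: (@le_trans _ _ (1 - pr G)); last by lra.
  by rewrite ler_piMl// subr_ge0.
have := PhiL; have := PhiU; rewrite lerDl gerBl => /(_ eta0) h1 /(_ eta0) h2.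
by apply/andP; split; lra.
Qed.

End cond.

Section main.
Context d (T : measurableType d) (R : realType) (P : probability T R).
Variables (xi : nat -> {RV P >-> R}) (M : phase_space R) (f : R -> R) (p x : R).
Hypotheses (fM : admissible_map M f) (xM : carrier M x).
Hypotheses (indep : independent_noise xi) (p2 : 2 < p).
Variables (c C : R).
Hypotheses (c0 : 0 < c) (C0 : 0 < C).
Hypothesis moments : moment_bounds xi p c C.
Variables (F kappa : R).
Hypotheses (F0 : 0 <= F) (k0 : 0 <= kappa) (FI : has_margin M -> 0 < F).
Hypothesis taylor : forall y u, carrier M y -> orbit_domain M u ->
  `|f u - f y - derive1 f y * (u - y)| <= kappa * F * (u - y) ^+ 2.
Variable s : R.
Hypotheses (s2 : 2 < s) (s3 : s <= 3) (sp : s <= p).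

Let fC y : carrier M y -> carrier M (f y).
Proof. by move=> My; apply: (admissible_maps fM); exact: (admissible_carrier fM My). Qed.

Let orbit_error n (sigma K : R) w : 0 < sigma -> 0 <= K ->
  (~` exit_event M xi sigma n) w -> sigma * max_noise xi n w <= K ->
  4 * (kappa * F) * Lambda_hat f x n ^+ 2 * K <= 1 ->
  `|noisy_orbit xi f sigma x n w - iter n f x - sigma * linear_noise xi f x n w|
    <= 4 * (kappa * F) * Lambda_hat f x n ^+ 3 * K ^+ 2.
Proof.
move=> s0 K0 Gw maxK small.
have := @orbit_linearization R f (carrier M) fC
  (fun y => @admissible_derivable R M f y fM) x xM n (orbit_domain M) (kappa * F)
  (mulr_ge0 k0 F0) taylor
  (fun i => noisy_orbit xi f sigma x i w) (fun j => sigma * xi j w) K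
  erefl (fun i => erefl) K0 _ (orbit_in_domain fM xM (ltW s0) Gw) small.
have -> : \sum_(1 <= j < n.+1) dflow f x n j * (sigma * xi j w) =
          sigma * linear_noise xi f x n w.
  by rewrite mulr_sumr; apply: eq_bigr => j _; rewrite mulrCA.
apply=> j jn; rewrite normrM gtr0_norm//.
by apply: le_trans maxK; rewrite ler_wpM2l ?(ltW s0)// max_noise_ge.
Qed.

(** On the interval F > 0, so that a bound on F * K keeps the kicks below the
width of the margin. *)
Let no_exit : exists2 r : R, 0 < r & forall sigma K n w,
  F * K <= r -> sigma * max_noise xi n w <= K -> (~` exit_event M xi sigma n) w.
Proof.
have noex (a r sigma K : R) n w : F * K <= r -> r <= a * F -> 0 < F ->
    sigma * max_noise xi n w <= K -> ~ (a < sigma * max_noise xi n w).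
  move=> FK ra F1 h /lt_le_trans /(_ h) aK.
  have : a * F < K * F by rewrite ltr_pM2r.
  by rewrite [K * F]mulrC; lra.
case: M FI fM => [||a] /= FI' aM; [by exists 1 => // *; case|by exists 1 => // *; case|].
have F1 := FI' isT; case: aM => a0 _ _.
exists (a * F); first by rewrite mulr_gt0.
by move=> sigma K n w FK; apply: noex FK _ F1.
Qed.

(** Below the threshold r the ratio D is at most 1/2, the kicks on B do not reach
the margin, and the smallness condition of the linearization holds on B. *)
Lemma effective_noise_clt : exists r A : R, [/\ 0 < r, 0 < A &
  forall (n : nat) (sigma : R), (0 < n)%N -> 0 < sigma ->
  ((Lambda_hat f x n ^+ 3 / sd_noise P xi f x n)%:E * F%:E
     * 'N[P]_(s%:E)[EFin \o max_noise xi n] ^+ 2 * sigma%:E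
   <= (lyapunov_ratio f x n s ^+ 2)%:E)%E ->
  exists B : set T, [/\ measurable B, B `<=` ~` exit_event M xi sigma n,
    lyapunov_ratio f x n s <= r -> 1 - lyapunov_ratio f x n s <= fine (P B) &
    forall z, `|cond_prob P (~` exit_event M xi sigma n)
       [set w | effective_noise P xi f sigma x n w * \1_B w <= z] - Phi z|
     <= A * lyapunov_ratio f x n s]].
Proof.
have [r1 r10 noex] := no_exit.
pose q := C / c.
have q0 : 0 < q by rewrite divr_gt0.
have kq0 : 0 < 4 * kappa * q + 1.
  by rewrite ltr_wpDl// mulr_ge0 ?(ltW q0)// mulr_ge0.
pose r := Num.min (2^-1) (Num.min (r1 / q) (4 * kappa * q + 1)^-1).
have r0 : 0 < r.
  rewrite !lt_min invr_gt0 ltr0n divr_gt0//= invr_gt0.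
  exact: kq0.
have [rh rr1 rq] : [/\ r <= 2^-1, q * r <= r1 & 4 * kappa * q * r <= 1].
  have : r <= r by []; rewrite {2}/r !le_min => /and3P[h1 h2 h3]; split=> //.
    by move: h2; rewrite ler_pdivlMr// mulrC.
  move: h3; rewrite -[X in _ <= X]mul1r (ler_pdivlMr _ _ kq0).
  by move: r0; lra.
pose A1 := (4 * stein_cst + 36) * (1 + C `^ p) / c `^ s : R.
have A10 : 0 <= A1.
  rewrite divr_ge0 ?powR_ge0// mulr_ge0 ?addr_ge0 ?powR_ge0// mulr_ge0//.
  exact: le_trans stein_cst_ge2.
exists r, (r^-1 + (A1 + 4 * kappa + 2)); split=> //.
  by rewrite ltr_wpDr ?invr_gt0// !addr_ge0// mulr_ge0.
move=> n sigma n0 s0 noise_small.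
set D := lyapunov_ratio f x n s.
have D0 : 0 < D by exact: lyapunov_ratio_gt0.
have mG : measurable (~` exit_event M xi sigma n).
  by apply: measurableC; exact: measurable_exit_event.
have [rD|Dr] := ltP r D.
  exists set0; split=> //.
  move=> z; apply: (@le_trans _ _ 1).
    set E := [set w | _].
    have mE : measurable (E `&` ~` exit_event M xi sigma n).
      by apply: measurable_effective_noise_event => //; exact: ltW.
    have h1 := cond_prob_le1 P mG mE.
    have h0 := cond_prob_ge0 P (~` exit_event M xi sigma n) E.
    rewrite ler_norml; have := Phi_ge0 z; have := Phi_le1 z.
    by rewrite /E in h0 *; move=> ? ?; apply/andP; split; lra.
  rewrite mulrDl; apply: (@le_trans _ _ (r^-1 * D)).
    by rewrite mulrC ler_pdivlMr// mul1r ltW.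
  by rewrite lerDl mulr_ge0 ?(ltW D0)// !addr_ge0// mulr_ge0.
have [_ _ cE _ _] := moments (ltn0Sn 0).
have [N [NE cN NP]] : exists N : R, [/\ ('N[P]_(s%:E)[EFin \o max_noise xi n] = N%:E)%E, c <= N &
    forall e : R, 0 < e -> fine (P [set w | N < e * max_noise xi n w]) <= e ^+ 2].
  apply: (max_noise_norm p2 n0 c0 s2 sp).
    by move=> j j0; have [] := moments j0.
  by case/andP: cE.
have N0 : 0 < N by exact: lt_le_trans cN.
move: noise_small; rewrite NE -EFin_expe -!EFinM lee_fin -/D.
set sd := sd_noise P xi f x n; set Lh := Lambda_hat f x n => small.
have sd0 : 0 < sd := sd_noise_gt0 c0 indep moments f x n0.
have sdC : sd <= C * Lh := sd_noise_le C0 indep moments f x n.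
have Lh1 : 1 <= Lh := Lambda_hat_ge1 f x n.
have Lh0 : 0 < Lh by lra.
(* Chebyshev's inequality at level e gives the probability e ^ 2 = D. *)
pose e : R := Num.sqrt D.
have e0 : 0 < e by rewrite sqrtr_gt0.
have eE : e ^+ 2 = D by rewrite sqr_sqrtr// ltW.
pose K := sigma * N / e.
have K0 : 0 < K by rewrite divr_gt0// mulr_gt0.
have e1 : e <= 1.
  by rewrite -(ler_pXn2r (_ : (0 < 2)%N)) ?nnegrE ?(ltW e0)// expr1n eE; lra.
have small1 : F * Lh ^+ 2 * K <= q * D.
  have h : Lh ^+ 2 / C * F * (N * c) * sigma <= D ^+ 2.
    apply: le_trans small; rewrite ler_wpM2r ?(ltW s0)//.
    apply: ler_pM; [by rewrite !mulr_ge0 ?invr_ge0 ?exprn_ge0// ltW|by rewrite mulr_ge0 ?ltW| |].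
      rewrite ler_wpM2r// ler_pdivrMr// mulrAC ler_pdivlMr//.
      have -> : Lh ^+ 3 * C = Lh ^+ 2 * (C * Lh) by ring.
      by apply: ler_wpM2l => //; rewrite exprn_ge0// ltW.
    by rewrite expr2 ler_wpM2l// ltW.
  have -> : F * Lh ^+ 2 * K = q / e * (Lh ^+ 2 / C * F * (N * c) * sigma).
    by rewrite /q /K; field; rewrite !gt_eqF.
  apply: (@le_trans _ _ (q / e * D ^+ 2)).
    by rewrite ler_wpM2l// divr_ge0// ltW.
  rewrite -mulrA ler_wpM2l ?(ltW q0)// mulrC ler_pdivrMr// expr2 ler_wpM2l ?(ltW D0)//.
  by rewrite -eE expr2 ler_piMl// ltW.
have small2 : 4 * (kappa * F) * Lh ^+ 2 * K <= 1.
  apply: le_trans rq.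
  have -> : 4 * (kappa * F) * Lh ^+ 2 * K = 4 * kappa * (F * Lh ^+ 2 * K) by ring.
  rewrite -[leRHS]mulrA ler_wpM2l ?mulr_ge0//; apply: le_trans small1 _.
  by rewrite ler_wpM2l// ltW.
have FK : F * K <= r1.
  apply: le_trans rr1; apply: le_trans (_ : q * D <= _); last by rewrite ler_wpM2l// ltW.
  apply: le_trans small1; rewrite ler_wpM2r ?(ltW K0)// ler_peMr//.
  by rewrite exprn_ege1.
pose B := ~` [set w | N < e * max_noise xi n w].
have mB : measurable B.
  apply: measurableC; apply: measurable_setb; apply: measurable_fun_ltr => //.
  by apply: measurable_funM => //; exact: measurable_max_noise.
have BK w : B w -> sigma * max_noise xi n w <= K.
  move=> /negP; rewrite -leNgt => h.
  by rewrite /K ler_pdivlMr// -mulrA ler_wpM2l ?(ltW s0)// mulrC.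
have BG : B `<=` ~` exit_event M xi sigma n.
  by move=> w Bw; apply: noex FK (BK w Bw).
have BD : fine (P (~` B)) <= D by rewrite /B setCK -eE; exact: NP.
exists B; split=> //.
  move=> _; have -> : P B = (1 - P (~` B))%E.
    by rewrite -[in LHS](setCK B) probability_setC//; exact: measurableC.
  rewrite fineB ?fin_num_measure//; last exact: measurableC.
  by rewrite /= lerD2l lerN2.
move=> z.
have := @cond_prob_approx _ _ _ P (~` exit_event M xi sigma n) B
  (effective_noise P xi f sigma x n) (fun w => linear_noise xi f x n w / sd) z
  (A1 * D) (4 * kappa * D) D mG mB BG.
have mL : measurable_fun setT (fun w => linear_noise xi f x n w / sd).
  by apply: measurable_funM => //; exact: measurable_linear_noise.
have mE := measurable_effective_noise_event xi fM xM z n (ltW s0) mB.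
have clt y := linear_noise_clt c0 indep moments f x n0 y s2 s3 sp.
have D1 : D < 1 by lra.
have kD0 : 0 <= 4 * kappa * D by rewrite mulr_ge0 ?(ltW D0)// mulr_ge0.
move=> /(_ mL mE clt _ kD0 BD D1) h; apply: le_trans (h _) _; last first.
  rewrite !mulrDl.
  have : 0 <= r^-1 * D by rewrite mulr_ge0 ?invr_ge0 ?(ltW r0) ?(ltW D0).
  lra.
move=> w Bw; rewrite /effective_noise -/sd.
have sS0 : 0 < sigma * sd by rewrite mulr_gt0.
rewrite (_ : linear_noise xi f x n w / sd =
  sigma * linear_noise xi f x n w / (sigma * sd)); last first.
  by field; rewrite !gt_eqF.
rewrite -mulrBl normrM normfV [`|sigma * sd|]gtr0_norm// ler_pdivrMr//.
apply: le_trans (orbit_error s0 (ltW K0) (BG w Bw) (BK w Bw) small2) _.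
have -> : 4 * (kappa * F) * Lh ^+ 3 * K ^+ 2 =
    4 * kappa * (Lh ^+ 3 / sd * F * N ^+ 2 * sigma) / D * (sigma * sd).
  rewrite -eE /K; field; rewrite !gt_eqF//.
rewrite ler_wpM2r ?(ltW sS0)// -mulrA ler_wpM2l ?mulr_ge0// ler_pdivrMr//.
Qed.

End main.

(** Lambda_2 is a partial sum of a geometric series, and Lambda_p >= 1. *)
Lemma affine_lyapunov_ratio_ge (R : realType) (f : R -> R) (x alpha p : R) (n : nat) :
  (0 < n)%N -> 0 <= p -> `|alpha| < 1 ->
  (forall j, (j <= n)%N -> dflow f x n j = alpha ^+ (n - j)) ->
  (1 - alpha ^+ 2) `^ (p / 2) <= lyapunov_ratio f x n p.
Proof.
move=> n0 p0 a1 dE.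
have b1 : 0 < 1 - alpha ^+ 2.
  by rewrite subr_gt0 -[ltLHS]real_normK ?num_real// expr_lt1.
have L2 : Lambda f 2 x n * (1 - alpha ^+ 2) <= 1.
  have -> : Lambda f 2 x n = \sum_(i < n) (alpha ^+ 2) ^+ i.
    rewrite Lambda2E big_add1 /= big_nat_rev /= big_mkord; apply: eq_bigr => i _.
    rewrite add0n -subSn ?subSS//; rewrite dE ?leq_subr// subKn ?(ltnW (ltn_ord i))//.
    by rewrite -!exprM mulnC.
  rewrite mulrC -opprB mulNr -subrX1 opprB gerBl.
  by rewrite exprn_ge0// sqr_ge0.
have L0 := Lambda2_gt0 f x n0.
rewrite /lyapunov_ratio ler_pdivlMr ?powR_gt0//.
rewrite -powRM ?(ltW b1) ?(ltW L0)//.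
apply: le_trans (Lambda_ge1 f x n0 p).
apply: (@le_trans _ _ (1 `^ (p / 2))); last by rewrite powR1.
apply: ge0_ler_powR.
- by rewrite divr_ge0.
- by rewrite nnegrE mulr_ge0// ltW.
- by rewrite nnegrE.
- by rewrite mulrC.
Qed.

Theorem theorem2p2 (R : realType) (d : measure_display) (T : measurableType d)
    (P : probability T R) (M : phase_space R) (f : R -> R)
    (xi : nat -> {RV P >-> R}) (p x : R) :
  admissible_map M f ->
  independent_noise xi ->
  2 < p ->
  noise_moments xi p ->
  carrier M x ->
  let s := Num.min p 3 in
  let ratio n := Lambda f s x n / Lambda f 2 x n `^ (s / 2) in
  exists2 A : R, 0 < A &
  forall (n : nat -> nat) (sigma : nat -> R),
    (forall k, (0 < n k)%N) ->
    (forall i j, (i < j)%N -> (n i < n j)%N) ->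
    Lambda f p x (n k) / Lambda f 2 x (n k) `^ (p / 2) @[k --> \oo] --> 0 ->
    (forall k, 0 < sigma k) ->
    (forall k,
      ((Lambda_hat f x (n k) ^+ 3 / sd_noise P xi f x (n k))%:E
        * C0_norm M f^`(2)
        * 'N[P]_(s%:E)[EFin \o max_noise xi (n k)] ^+ 2
        * (sigma k)%:E <= (ratio (n k) ^+ 2)%:E)%E) ->
    exists B : nat -> set T,
      [/\ forall k, measurable (B k),
          forall k, B k `<=` ~` exit_event M xi (sigma k) (n k),
          P (B k) @[k --> \oo] --> 1%E &
          forall k,
            (ereal_sup [set
               (`|cond_prob P (~` exit_event M xi (sigma k) (n k))
                    [set w | (effective_noise P xi f (sigma k) x (n k) w
                              * \1_(B k) w <= z)%R]
                  - Phi z|)%:E | z in [set: R]]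
             <= (A * ratio (n k))%:E)%E].
Proof.
move=> fM indep p2 mom xM s ratio.
have s2 : 2 < s by rewrite /s lt_min p2/=; lra.
have s3 : s <= 3 by rewrite /s ge_min lexx orbT.
have sp : s <= p by rewrite /s ge_min lexx.
have [c [C [c0 C0 moments]]] := noise_moment_bounds p2 mom.
case FE : (C0_norm M f^`(2)) => [F||].
- have F0 : 0 <= F by rewrite -lee_fin -FE; exact: admissible_C0_norm_ge0.
  have [FI|noFI] := pselect (has_margin M -> 0 < F); last first.
    have {noFI} [a aM FE0] : exists2 a, M = Defs.Interval a & C0_norm M f^`(2) = 0%E.
      move: noFI; rewrite FE; case: (M) => [noFI|noFI|a noFI]; [by case: noFI|by case: noFI|].
      exists a => //; congr EFin; apply/eqP; rewrite eq_le F0 andbT leNgt.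
      by apply/negP => F1; case: noFI.
    subst M; have [alpha a1 dE] := affine_interval fM FE0 xM.
    exists 1 => // n sigma n0 _ rp0; exfalso.
    have q0 : 0 < (1 - alpha ^+ 2) `^ (p / 2).
      by rewrite powR_gt0// subr_gt0 -[ltLHS]real_normK ?num_real// expr_lt1.
    move/cvgrPdist_lt : rp0 => /(_ _ q0) [k _ /(_ k (leqnn k))].
    rewrite sub0r normrN -/(lyapunov_ratio f x (n k) p) gtr0_norm ?lyapunov_ratio_gt0//.
    rewrite ltNge affine_lyapunov_ratio_ge//; first lra.
    by move=> j; exact: dE.
  have [kappa k0 taylor] := admissible_taylor fM FE FI.
  have [r [A [r0 A0 clt]]] :=
    effective_noise_clt fM xM indep p2 c0 C0 moments F0 k0 FI taylor s2 s3 sp.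
  exists A => // n sigma n0 _ rp0 s0 small.
  have {clt small} Bk k := clt (n k) (sigma k) (n0 k) (s0 k) (small k).
  have [B BP] := choice Bk; exists B; split=> [k|k||k].
  + by have [] := BP k.
  + by have [] := BP k.
  + have rs0 := lyapunov_ratio_cvg0 n0 s2 sp rp0.
    apply/cvg_EFin.
      by near=> k; rewrite fin_num_measure//; have [] := BP k.
    apply/cvgrPdist_le => e e0.
    near=> k.
    have [mB _ BD _] := BP k.
    have D0 := lyapunov_ratio_gt0 f x (n0 k) s.
    have /BD Bge : lyapunov_ratio f x (n k) s <= r.
      rewrite -(gtr0_norm D0) -normrN -[X in `|X|]add0r.
      by near: k; move/cvgrPdist_le : rs0 => /(_ _ r0).
    have De : lyapunov_ratio f x (n k) s <= e.
      rewrite -(gtr0_norm D0) -normrN -[X in `|X|]add0r.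
      by near: k; move/cvgrPdist_le : rs0 => /(_ _ e0).
    have B1 : fine (P (B k)) <= 1.
      by rewrite -lee_fin fineK ?fin_num_measure// probability_le1.
    by rewrite /= ger0_norm ?subr_ge0//; lra.
  + have [_ _ _ BA] := BP k.
    by apply: ub_ereal_sup => _ [z _ <-]; rewrite lee_fin; exact: BA.
- exists 1 => // n sigma n0 _ _ s0 /(_ 0%N) small; exfalso.
  have [_ _ cE _ _] := moments 1%N isT.
  have [N [NE cN _]] : exists N : R, [/\ ('N[P]_(s%:E)[EFin \o max_noise xi (n 0%N)] = N%:E)%E, c <= N &
    forall e : R, 0 < e -> fine (P [set w | N < e * max_noise xi (n 0%N) w]) <= e ^+ 2].
    apply: (max_noise_norm p2 (n0 0%N) c0 s2 sp).
      by move=> j j0; have [] := moments j j0.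
    by case/andP: cE.
  have N0 : 0 < N by exact: lt_le_trans cN.
  have sd0 := sd_noise_gt0 c0 indep moments f x (n0 0%N).
  have Lh1 := Lambda_hat_ge1 f x (n 0%N).
  have q0 : 0 < Lambda_hat f x (n 0%N) ^+ 3 / sd_noise P xi f x (n 0%N).
    by rewrite divr_gt0// exprn_gt0//; lra.
  move: small; rewrite NE -EFin_expe gt0_muley ?lte_fin// gt0_mulye ?lte_fin ?exprn_gt0//.
  by rewrite gt0_mulye ?lte_fin//.
- by have := admissible_C0_norm_ge0 M f; rewrite FE.
Unshelve. all: by end_near. Qed.
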